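(* Let $q\ge 2$, $1\le u<v\le q$, let $M=M^{[q]}_{u,v}$ (a $2q$-dimensional Dieudonné module), and let $\omega_{u,v}\in\mathfrak S_{2q}$ be its Siegel Ekedahl–Oort permutation. Then $\omega_{u,v}=\mathrm{id}$ if $(u,v)=(1,2)$, and otherwise, for $1\le i\le q$, $\omega_{u,v}(i)$ is given by: (a) $u=1$, $v>2$: $\omega(i)=i$ if $i<q+2-v$; $q+1$ if $i=q+2-v$; $i-1$ if $q+2-v<i<q$; $q+2$ if $i=q$. (b) $u=2$, $v=q$: $\omega(i)=q+i$ if $i\le 2$; $i-2$ if $2<i\le q$. (c) $u=2$, $1<q+1-v\le v-2$: $\omega(1)=1$; $\omega(2)=q+1$; $\omega(i)=i-1$ if $2<i<q+2-v$; $q+2$ if $i=q+2-v$; $i-2$ if $q+2-v<i\le q$. (d) $u=2$, $q+1-v>v-2$: $\omega(1)=1$; $\omega(2)=q+1$; $\omega(i)=i-1$ if $2<i<q+3-v$; $q+2$ if $i=q+3-v$; $i-2$ if $q+3-v<i\le q$. (e) $2<u<q-1$, $v=q-1$: $\omega(1)=1$; $\omega(i)=q+i-1$ if $1<i\le 4$; $i-3$ if $4<i<q+3-u$; $q+4$ if $i=q+3-u$; $i-4$ if $q+3-u<i\le q$. (f) $2<u<q-1$, $v=q$: $\omega(i)=q+i$ if $1\le i\le 2$; $\omega(3)=1$; $\omega(4)=q+3$; $\omega(i)=i-3$ if $4<i<q+3-u$; $q+4$ if $i=q+3-u$; $i-4$ if $q+3-u<i\le q$. (g) $2<u<q-1$,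 $v<q-1$: $\omega(i)=i$ if $1\le i\le2$; $q+i-2$ if $3\le i\le 4$; $i-2$ if $4<i<q+3-v$; $q+3$ if $i=q+3-v$; $i-3$ if $q+3-v<i<q+3-u$; $q+4$ if $i=q+3-u$; $i-4$ if $q+3-u<i\le q$. (h) $u=q-1$: $\omega(i)=q+i$ if $1\le i\le 4$; $i-4$ if $4<i\le q$.
   Context: Let $k=\overline{\mathbb F}_p$, $p>2$. A Dieudonné module is a finite-dimensional $k$-space with Frobenius-semilinear $F$ and Frobenius$^{-1}$-semilinear $V$. For a subspace $W$, $V^{-1}(W)=\{x:Vx\in W\}$. A final filtration of a $2q$-dimensional Dieudonné module $D$ is a full flag $0=W_0\subset\cdots\subset W_{2q}=D$, $\dim W_j=j$, such that $F(W_j)$ and $V^{-1}(W_j)$ are members of the flag for all $j$. The module $M^{[q]}_{u,v}$ (standard object of the Ekedahl–Oort stratum $\gamma_{u,v}$ of the unitary Shimura variety $\mathcal M(q-2,2)$, $p$ inert): basis $e_{i,j}$, $i\in\{1,2\}$, $1\le j\le q$, with $F,V$ the semilinear extensions of $F(e_{1,j})=0$ if $j\in\{u,v\}$; $=e_{2,j}$ if $1\le j\le u-1$; $=e_{2,j-1}$ if $u<j\le v-1$; $=e_{2,j-2}$ if $j>v$. $V(e_{1,j})=0$ if $j\in\{1,2\}$; $=e_{2,j-2}$ if $2<j\le q-v+2$; $=e_{2,j-1}$ if $q-v+2<j\le q-u+1$; $=e_{2,j}$ if $j>q-u+1$. $F(e_{2,j})=e_{1,1}$ if $j=q-v+1$;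 $=e_{1,2}$ if $j=q-u+1$; $=0$ otherwise. $V(e_{2,j})=e_{1,u}$ if $j=q-1$; $=e_{1,v}$ if $j=q$; $=0$ otherwise. Siegel Ekedahl–Oort permutation (Moonen's indexing of Ekedahl–Oort strata of $\mathcal A_q$): for a $2q$-dimensional (polarized) Dieudonné module $D$ with $\dim\ker F=q$, take a final filtration and let $\eta(j)=\dim(W_j\cap\ker F)$. Let $j_1<\cdots<j_q$ be the indices with $\eta(j_l)=\eta(j_l-1)+1$ and $i_1<\cdots<i_q$ the remaining indices in $\{1,\dots,2q\}$. The permutation $\omega\in\mathfrak S_{2q}$ is defined by $\omega(j_l)=l$ and $\omega(i_m)=q+m$; it does not depend on the choice of final filtration. For $D=M^{[q]}_{u,v}$ it is denoted $\omega_{u,v}$ (it indexes the Ekedahl–Oort stratum of $\mathcal A_q$ containing the image of $\mathcal M(q-2,2)_{\gamma_{u,v}}$ under the map forgetting the $\mathcal O_K$-action).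
   Formalization: Case (h), u = q−1, is stated only for u > 2; this excludes just (q,u,v) = (3,2,3), where (b) gives ω(3) = 1 but (h) would give ω(3) = 6, and there the formula of (b) is the one proved. *)

(* Defs.v *)
From HB Require Import structures.
From mathcomp Require Import all_boot all_order all_fingroup all_algebra all_field.

Set Implicit Arguments.
Unset Strict Implicit.
Unset Printing Implicit Defensive.

Import GRing.Theory.
Local Open Scope ring_scope.

Section InverseFrobenius.

Variables (p : nat) (k : closedFieldType) (charkp : p \in [pchar k]).

Lemma frobenius_surj (x : k) : exists y, y ^+ p == x.
Proof.
have p_gt0 : (0 < p)%N by apply: prime_gt0; apply: pcharf_prime charkp.
have [y def_y] := @solve_monicpoly k p (fun i => if i == 0%N then x else 0) p_gt0.
exists y; apply/eqP; rewrite {}def_y.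
case: p p_gt0 => // n _; rewrite big_ord_recl /= expr0 mulr1.
by rewrite big1 ?addr0 // => i _; rewrite mul0r.
Qed.

Definition frobenius_inv (x : k) : k := xchoose (frobenius_surj x).

Lemma frobenius_invK : cancel frobenius_inv (pFrobenius_aut charkp).
Proof. by move=> x; apply/eqP; apply: (xchooseP (frobenius_surj x)). Qed.

Lemma frobeniusK : cancel (pFrobenius_aut charkp) frobenius_inv.
Proof.
move=> x; apply: (fmorph_inj (pFrobenius_aut charkp)).
exact: (frobenius_invK (pFrobenius_aut charkp x)).
Qed.

Fact frobenius_inv_is_zmod_morphism : zmod_morphism frobenius_inv.
Proof. exact: can2_zmod_morphism frobeniusK frobenius_invK. Qed.

Fact frobenius_inv_is_monoid_morphism : monoid_morphism frobenius_inv.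
Proof. exact: can2_monoid_morphism frobeniusK frobenius_invK. Qed.

HB.instance Definition _ :=
  GRing.isZmodMorphism.Build k k frobenius_inv frobenius_inv_is_zmod_morphism.
HB.instance Definition _ :=
  GRing.isMonoidMorphism.Build k k frobenius_inv frobenius_inv_is_monoid_morphism.

End InverseFrobenius.

Record dieudonneModule (p : nat) (k : closedFieldType) (charkp : p \in [pchar k]) :=
  DieudonneModule {
    dm_space :> vectType k;
    dm_F : {linear dm_space -> dm_space | pFrobenius_aut charkp \; *:%R};
    dm_V : {linear dm_space -> dm_space | frobenius_inv charkp \; *:%R}
  }.

Section EkedahlOort.

Variables (p : nat) (k : closedFieldType) (charkp : p \in [pchar k]).
Variables (D : dieudonneModule charkp) (q : nat).

(* Only W 0, ..., W (2 * q) are relevant. *)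
Definition final_filtration (W : nat -> {vspace D}) : Prop :=
  [/\ W 0%N = 0%VS /\ W (2 * q)%N = fullv,
      forall j, (j < 2 * q)%N -> (W j <= W j.+1)%VS,
      forall j, (j <= 2 * q)%N -> \dim (W j) = j,
      forall j, (j <= 2 * q)%N -> exists2 i, (i <= 2 * q)%N &
        forall x, x \in W i <-> exists2 y, y \in W j & x = dm_F D y
    & forall j, (j <= 2 * q)%N -> exists2 i, (i <= 2 * q)%N &
        forall x, x \in W i <-> dm_V D x \in W j].

Definition is_kerF (K : {vspace D}) : Prop := forall x, x \in K <-> dm_F D x = 0.

(* eta W K j is dim (W_j :&: ker F) when is_kerF K. *)
Definition eta (W : nat -> {vspace D}) (K : {vspace D}) (j : nat) : nat :=
  \dim (W j :&: K).

(* The ordinal i : 'I_(2 * q) encodes the 1-based index i.+1, and likewise for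
   the values of a permutation of 'I_(2 * q). *)
Definition jumps W K : seq 'I_(2 * q) :=
  [seq i : 'I_(2 * q) <- enum 'I_(2 * q) | eta W K i.+1 == (eta W K i).+1].

Definition nonjumps W K : seq 'I_(2 * q) :=
  [seq i : 'I_(2 * q) <- enum 'I_(2 * q) | eta W K i.+1 != (eta W K i).+1].

Definition siegel_EO_perm (w : 'S_(2 * q)) : Prop :=
  exists (W : nat -> {vspace D}) (K : {vspace D}),
  [/\ final_filtration W,
      is_kerF K /\ \dim K = q,
      [seq (w i).+1 | i <- jumps W K] = iota 1 q
    & [seq (w i).+1 | i <- nonjumps W K] = iota q.+1 q].

End EkedahlOort.

Section StandardModule.

Variables (p : nat) (k : closedFieldType) (charkp : p \in [pchar k]).
Variables (q u v : nat).

(* The basis vector e_{i,j}, with 1-based indices 1 <= i <= 2 and 1 <= j <= q. *)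
Definition std_basis (i j : nat) : 'M[k]_(2, q) :=
  \matrix_(a < 2, b < q) ((a.+1 == i) && (b.+1 == j))%:R.

Local Notation e := std_basis.

Definition std_F1 (j : nat) : 'M[k]_(2, q) :=
  if (j == u) || (j == v) then 0
  else if (j <= u - 1)%N then e 2 j
  else if (j <= v - 1)%N then e 2 (j - 1)
  else e 2 (j - 2).

Definition std_V1 (j : nat) : 'M[k]_(2, q) :=
  if (j <= 2)%N then 0
  else if (j <= q - v + 2)%N then e 2 (j - 2)
  else if (j <= q - u + 1)%N then e 2 (j - 1)
  else e 2 j.

Definition std_F2 (j : nat) : 'M[k]_(2, q) :=
  if (j == q - v + 1)%N then e 1 1
  else if (j == q - u + 1)%N then e 1 2
  else 0.

Definition std_V2 (j : nat) : 'M[k]_(2, q) :=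
  if (j == q - 1)%N then e 1 u
  else if (j == q)%N then e 1 v
  else 0.

(* The row of index a : 'I_2 holds the coordinates on e_{a.+1,1}, ..., e_{a.+1,q}. *)
Definition std_F (x : 'M[k]_(2, q)) : 'M[k]_(2, q) :=
  \sum_(b < q) (pFrobenius_aut charkp (x 0 b) *: std_F1 b.+1
              + pFrobenius_aut charkp (x 1 b) *: std_F2 b.+1).

Definition std_V (x : 'M[k]_(2, q)) : 'M[k]_(2, q) :=
  \sum_(b < q) (frobenius_inv charkp (x 0 b) *: std_V1 b.+1
              + frobenius_inv charkp (x 1 b) *: std_V2 b.+1).

Fact std_F_is_semilinear : linear_for (pFrobenius_aut charkp \; *:%R) std_F.
Proof.
move=> a x y; rewrite /std_F /= scaler_sumr -big_split; apply: eq_bigr => b _ /=.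
by rewrite !mxE !rmorphD !rmorphM /= !scalerDl scalerDr !scalerA addrACA.
Qed.

Fact std_V_is_semilinear : linear_for (frobenius_inv charkp \; *:%R) std_V.
Proof.
move=> a x y; rewrite /std_V /= scaler_sumr -big_split; apply: eq_bigr => b _ /=.
by rewrite !mxE !rmorphD !rmorphM /= !scalerDl scalerDr !scalerA addrACA.
Qed.

HB.instance Definition _ := GRing.isLinear.Build k 'M[k]_(2, q) 'M[k]_(2, q)
  (pFrobenius_aut charkp \; *:%R) std_F std_F_is_semilinear.
HB.instance Definition _ := GRing.isLinear.Build k 'M[k]_(2, q) 'M[k]_(2, q)
  (frobenius_inv charkp \; *:%R) std_V std_V_is_semilinear.

Definition std_module : dieudonneModule charkp :=
  @DieudonneModule p k charkp 'M[k]_(2, q) std_F std_V.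

End StandardModule.

(* The 1-based permutation encoded by w agrees with f on {1, ..., q}. *)
Definition first_half_eq (q : nat) (w : 'S_(2 * q)) (f : nat -> nat) : Prop :=
  forall i : 'I_(2 * q), (i.+1 <= q)%N -> (w i).+1 = f i.+1.

(* Main.v *)
(* Uniqueness: the indices s at which two final filtrations agree are closed
   under s |-> s - eta s and s |-> q + eta s (semilinear rank-nullity for F and
   V, as Im V = Ker F).  The map sending an index to its image under F or V^-1 is
   a permutation whose inverse respects the blocks cut out by these s, hence so
   does the permutation itself, and eta has slope constantly 0 or 1 on a block.

   Existence: both F and V^-1 preserve the order of the bases (e_{1,j})_j and
   (e_{2,j})_j, so it suffices to shuffle these two bases; a shuffle is final as
   soon as the positions of e_{1,1}, e_{1,2}, e_{2,q-1}, e_{2,q} satisfy four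
   fixed-point conditions.  When u > 1 and v = q the vectors e_{1,1} and e_{2,1}
   are swapped by F (and e_{1,q}, e_{2,q} by V), so no shuffle is final; the flag
   then passes through e_{1,1} + e_{2,1} instead. *)
Require Import Defs.
From HB Require Import structures.
From mathcomp Require Import all_boot all_order all_fingroup all_algebra all_field.
From mathcomp Require Import zify.

Set Implicit Arguments.
Unset Strict Implicit.
Unset Printing Implicit Defensive.

Import GRing.Theory.

(** * Rigidity of eta *)

Section Rigidity.

Variable q : nat.

(** Positions are 0-based. [F(W_{2q}) = F(D)] is spanned by [e_{1,1}], [e_{1,2}] and
    [e_{2,1}, ..., e_{2,q-2}], so it has to be [W_q]. A shuffle is thus free only in where these two
    vectors of row one enter below [q], and where [e_{2,q-1}], [e_{2,q}] enter above it. Since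
    [e_{1,1} = F(e_{2,q-v+1})], its position must be the number of [e_{1,j}] outside [Ker F] that
    precede [e_{2,q-v+1}], a number that depends on the shuffle itself; that of [e_{1,2}] is one
    more than the corresponding number for [e_{2,q-u+1}]. Dually, [e_{2,q-1}] sits at [q] plus the
    number of [e_{2,j}] in [Ker F] that precede [e_{1,u}], and [e_{2,q}] at [q + 1] plus the number
    that precede [e_{1,v}]. Solving these equations yields the constants of each case. For [u > 1],
    [v = q] the first one has no solution; the sum [e_{1,1} + e_{2,1}] is then fixed by [F] because
    Frobenius fixes the coefficient 1. *)

Definition unit_steps (h : nat -> nat) : Prop :=
  [/\ h 0 = 0, h (2 * q) = q
    & forall j, j < 2 * q -> h j <= h j.+1 <= (h j).+1].

Definition jump (h : nat -> nat) (j : nat) : bool := h j.+1 == (h j).+1.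

(** For [h = eta], the numbers [s - h s] and [q + h s] are the dimensions of [F(W_s)] and
    [V^-1(W_s)]. *)
Definition step_closed (h : nat -> nat) (S : pred nat) : Prop :=
  forall s, s <= 2 * q -> S s -> S (s - h s) /\ S (q + h s).

Lemma unit_steps_mono h : unit_steps h -> forall i j,
  i <= j -> j <= 2 * q -> h i <= h j /\ h j + i <= h i + j.
Proof.
case=> _ _ st i; elim=> [|j IHj]; first by rewrite leqn0 => /eqP->.
rewrite leq_eqVlt => /predU1P[-> //|]; rewrite ltnS => le_ij lt_j.
have [IH1 IH2] := IHj le_ij (ltnW lt_j).
by have /andP[] := st j lt_j; split; lia.
Qed.

Lemma unit_steps_le h : unit_steps h -> forall j, j <= 2 * q -> h j <= j.
Proof.
by move=> ush j le_j; have := unit_steps_mono ush (leq0n j) le_j; case: ush; lia.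
Qed.

Section Block.

Variables (h : nat -> nat) (S : pred nat).
Hypotheses (ush : unit_steps h) (S0 : S 0) (closS : step_closed h S).

(** Index [i] stands for the graded piece [W_{i+1}/W_i]: a jump comes from [Ker F] and is carried up
    by [V^-1], a non-jump is carried down by [F]. *)
Let move_val (i : nat) : nat := if jump h i then q + h i else i - h i.

Let move_val_lt (i : 'I_(2 * q)) : move_val i < 2 * q.
Proof.
have [h0 h2q st] := ush; have := st _ (ltn_ord i).
have := unit_steps_mono ush (ltn_ord i) (leqnn _).
by have := unit_steps_le ush (ltn_ord i); rewrite /move_val /jump; case: eqP; lia.
Qed.

Let move_val_ge i : i < 2 * q -> (q <= move_val i) = jump h i.
Proof.
move=> lt_i; have [h0 h2q st] := ush; have := st _ lt_i.
have := unit_steps_mono ush lt_i (leqnn _).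
by have := unit_steps_le ush lt_i; rewrite /move_val /jump; case: eqP; lia.
Qed.

(** Taking [s := j] gives strict monotonicity among indices of one kind, hence injectivity; the
    other [s] show that separators keep separating. *)
Let move_val_homo i j : i < j -> j < 2 * q -> jump h i = jump h j ->
  forall s, i < s -> s <= j ->
  (if jump h j then q + h s else s - h s) <= move_val j
  /\ move_val i < (if jump h j then q + h s else s - h s).
Proof.
move=> lt_ij lt_j eq_ij s lt_is le_sj; have [h0 h2q st] := ush.
have lt_i := ltn_trans lt_ij lt_j.
have := unit_steps_mono ush lt_is (leq_trans le_sj (ltnW lt_j)).
have := unit_steps_mono ush le_sj (ltnW lt_j).
have := unit_steps_le ush (ltnW lt_j).
have := unit_steps_le ush (ltnW lt_i).
have := unit_steps_le ush (leq_trans le_sj (ltnW lt_j)).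
have := st _ lt_i.
rewrite /move_val eq_ij; case: ifP => jj; rewrite -eq_ij /jump in jj; lia.
Qed.

(** The test is [s <= i] and not [s < i] because [i] is the step from [i] to [i.+1]: a separator [s]
    lies to the left of step [s]. *)
Definition same_block (i j : nat) : Prop :=
  forall s, s <= 2 * q -> S s -> (s <= i) = (s <= j).

Let Sq : S q.
Proof. by have [] := closS (leq0n _) S0; have [-> _ _] := ush; rewrite addn0. Qed.

Let move_jump i j : i < 2 * q -> j < 2 * q ->
  same_block (move_val i) (move_val j) -> jump h i = jump h j.
Proof.
move=> lt_i lt_j /(_ q); rewrite !move_val_ge //; apply=> //.
by rewrite leq_pmull.
Qed.

(** A separator [s] with [i < s <= j] would be carried by [step_closed] to [s - h s] or [q + h s],
    according to the common kind of [i] and [j], and that point separates the images. *)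
Let move_sep i j : i < j -> j < 2 * q ->
  same_block (move_val i) (move_val j) -> same_block i j.
Proof.
move=> lt_ij lt_j sb s le_s Ss; have lt_i := ltn_trans lt_ij lt_j.
have eq_ij := move_jump lt_i lt_j sb.
case: (leqP s i) => [le_si|lt_is]; first by rewrite (leq_trans le_si (ltnW lt_ij)).
apply/esym/negbTE/negP => le_sj.
have [le1 lt1] := move_val_homo lt_ij lt_j eq_ij lt_is le_sj.
have [S1 S2] := closS le_s Ss.
have := sb (if jump h j then q + h s else s - h s).
rewrite le1 [_ <= move_val i]leqNgt lt1 /=; case: ifP => _ nope; suff: false = true by [].
  apply: nope => //; have [_ h2q _] := ush.
  by have := unit_steps_mono ush le_s (leqnn _); lia.
by apply: nope => //; apply: leq_trans (leq_subr _ _) le_s.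
Qed.

Let move_block i j : i < 2 * q -> j < 2 * q ->
  same_block (move_val i) (move_val j) -> same_block i j.
Proof.
have sym a b : same_block a b -> same_block b a by move=> sb s le_s /sb->.
by case: (ltngtP i j) => [lt_ij _ lt_j|lt_ji lt_i _ /sym/move_sep sb|-> //];
  [apply: move_sep | apply: sym; apply: sb].
Qed.

(* The map i |-> i - h i or q + h i is a permutation T of the indices whose
   inverse preserves blocks; T is a power of its inverse, so it preserves them
   too, while the separator q distinguishes T (jump) from T (non-jump). *)
Lemma block_jump i j : i < 2 * q -> j < 2 * q -> same_block i j ->
  jump h i = jump h j.
Proof.
move=> lt_i lt_j sb_ij.
pose T0 (i : 'I_(2 * q)) := Ordinal (move_val_lt i).
have T0_inj : injective T0.
  move=> a b /(congr1 val) /= eq_ab; apply/val_inj => /=.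
  have eqJ : jump h a = jump h b by rewrite -!move_val_ge ?eq_ab.
  case: (ltngtP a b) => // [lt_ab|lt_ba].
    by have := move_val_homo lt_ab (ltn_ord b) eqJ lt_ab (leqnn _); lia.
  by have := move_val_homo lt_ba (ltn_ord a) (esym eqJ) lt_ba (leqnn _); lia.
pose T := perm T0_inj.
have TV (a b : 'I_(2 * q)) : same_block a b -> same_block (T^-1%g a) (T^-1%g b).
  move=> sb; apply: move_block; rewrite ?ltn_ord //.
  have TE (c : 'I_(2 * q)) : move_val c = T c :> nat by rewrite permE.
  by rewrite !TE !permKV.
have TVn n (a b : 'I_(2 * q)) :
    same_block a b -> same_block ((T^-1 ^+ n)%g a) ((T^-1 ^+ n)%g b).
  by elim: n => [|n IHn] sb; rewrite ?expg0 ?perm1 // expgSr !permM; apply/TV/IHn.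
have := TVn #[T^-1]%g.-1 (Ordinal lt_i) (Ordinal lt_j) sb_ij.
rewrite -invg_expg invgK !permE /=; exact: move_jump.
Qed.

End Block.

Lemma jump_run h s t (b : bool) : s <= t ->
  (forall i, s <= i < t -> h i.+1 = b + h i) -> h t = b * (t - s) + h s.
Proof.
move=> le_st; rewrite -(subnK le_st); elim: (t - s) => [|n IHn] run.
  by rewrite subnn muln0.
by rewrite addSn run ?IHn => [|i ?|]; try (rewrite run //); nia.
Qed.

(** Between consecutive points [s < t] of [S] both functions have constant slope 0 or 1, and the
    common increment [h t - h s] tells which slope it is. *)
Lemma unit_steps_eq h h' (S : pred nat) :
    unit_steps h -> unit_steps h' -> S 0 -> S (2 * q) ->
    step_closed h S -> step_closed h' S ->
    (forall s, s <= 2 * q -> S s -> h s = h' s) ->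
  forall j, j <= 2 * q -> h j = h' j.
Proof.
move=> ush ush' S0 S2q cl cl' eqS.
have step_eq f : unit_steps f -> forall i, i < 2 * q -> f i.+1 = jump f i + f i.
  by case=> _ _ st i /st; rewrite /jump; case: eqP; lia.
have jump_eq j : j < 2 * q -> jump h j = jump h' j.
  move=> lt_j.
  have ex_t : exists t, S t && (j < t) by exists (2 * q); rewrite S2q.
  have ex_s : exists s, S s && (s <= j) by exists 0; rewrite S0.
  case: (ex_minnP ex_t) => t /andP[St lt_jt] t_min.
  have bd_s s : S s && (s <= j) -> s <= j by case/andP.
  case: (ex_maxnP ex_s bd_s) => s /andP[Ss le_sj] s_max.
  have le_t : t <= 2 * q by apply: t_min; rewrite S2q.
  have le_s : s <= 2 * q by lia.
  have sb i : s <= i < t -> same_block S i j.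
    move=> lt_i r le_r Sr; case: (leqP r j) => [le_rj|lt_jr].
      by have := s_max r; rewrite Sr le_rj => /(_ isT); lia.
    by have := t_min r; rewrite Sr lt_jr => /(_ isT); lia.
  have run f : unit_steps f -> step_closed f S -> f t = jump f j * (t - s) + f s.
    move=> usf clf; apply: jump_run; first by lia.
    by move=> i lt_i; rewrite (step_eq f) ?(block_jump usf S0 clf _ lt_j (sb i lt_i)) //; lia.
  have := run h ush cl; have := run h' ush' cl'; rewrite -!eqS //.
  by do 2!case: (jump _ j); lia.
elim=> [|j IHj] lt_j; first by rewrite eqS.
by rewrite (step_eq h) // (step_eq h') // jump_eq // IHj // ltnW.
Qed.

End Rigidity.

(** * Final filtrations and their permutations *)

(** Rank-nullity on the complement [C] of [U :&: K] in [U]. As [t] is a right inverse of [s], a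
    relation with coefficients [d i] among the images is the image of the combination with
    coefficients [t (d i)], which lies in [C :&: K = 0]. *)
Lemma semilinear_dim (k : fieldType) (vT wT : vectType k) (s t : k -> k)
    (f : vT -> wT) (U K : {vspace vT}) (Z : {vspace wT}) :
    s 0%R = 0%R -> cancel t s ->
    {morph f : x y / (x + y)%R} -> (forall a x, f (a *: x) = s a *: f x)%R ->
    (forall x, x \in K <-> f x = 0%R) ->
    (forall z, z \in Z <-> exists2 x, x \in U & z = f x) ->
  \dim (U :&: K) + \dim Z = \dim U.
Proof.
move=> s0 tK fD fZ memK memZ; rewrite -(dimv_cap_compl U K); congr addn.
set C := (U :\: K)%VS; set b := vbasis C.
have f0 : f 0%R = 0%R by rewrite -(scale0r 0%R) fZ s0 scale0r.
have fsum n (c : 'I_n -> k) (X : 'I_n -> vT) :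
    f (\sum_i c i *: X i)%R = (\sum_i s (c i) *: f (X i))%R.
  by rewrite (big_morph f fD f0); apply: eq_bigr => i _; rewrite fZ.
have bC (i : nat) : (b`_i)%R \in C.
  case: (ltnP i (\dim C)) => [lt_i|ge_i]; last by rewrite nth_default ?size_tuple ?mem0v.
  by apply: vbasis_mem; rewrite mem_nth ?size_tuple.
pose X := [tuple of map f b].
have XE (i : 'I_(\dim C)) : (X`_i)%R = f (b`_i)%R by rewrite (nth_map 0%R) ?size_tuple.
have freeX : free X.
  apply/freeP => d; rewrite (eq_bigr (fun i => f (t (d i) *: (b`_i)%R))%R); last first.
    by move=> i _; rewrite XE fZ tK.
  rewrite -(big_morph f fD f0) => /memK inK.
  have : (\sum_(i < \dim C) t (d i) *: (b`_i)%R)%R \in (C :&: K)%VS.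
    by rewrite memv_cap inK andbT rpred_sum // => i _; rewrite rpredZ ?bC.
  rewrite capv_diff memv0 => /eqP sum0 i.
  by move/freeP: (basis_free (vbasisP C)) => /(_ (t \o d) sum0 i)/= ti; rewrite -[d i]tK ti.
have spanX : <<X>>%VS = Z.
  apply/eqP; rewrite eqEsubv; apply/andP; split.
    apply/span_subvP => _ /mapP[x xb ->]; apply/memZ; exists x => //.
    exact: (subvP (diffvSl U K)) (vbasis_mem xb).
  apply/subvP => z /memZ[x]; rewrite -{1}(addv_diff_cap U K) => /memv_addP[y yC [y' ]].
  rewrite memv_cap => /andP[_ /memK fy'] -> ->; rewrite fD fy' addr0.
  rewrite (coord_vbasis yC) fsum; apply: rpred_sum => i _; rewrite rpredZ // -XE.
  by rewrite memv_span ?mem_nth ?size_tuple.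
by rewrite -spanX; move: freeX; rewrite /free size_tuple => /eqP.
Qed.

(** * Permutations determined by a set of jumps *)

Section PermOfJumps.

Variables (n q : nat) (p : pred nat).

Local Notation J := [seq i : 'I_n <- enum 'I_n | p i].
Local Notation N := [seq i : 'I_n <- enum 'I_n | ~~ p i].

Lemma nth_filter_ord (a : pred nat) (i : 'I_n) : a i ->
  nth i [seq j : 'I_n <- enum 'I_n | a j] (count a (iota 0 i)) = i.
Proof.
move=> ai; have lt_i := ltn_ord i.
rewrite -{1}(cat_take_drop i (enum 'I_n)) (drop_nth i) ?size_enum_ord //.
rewrite nth_ord_enum filter_cat /= ai nth_cat size_filter.
suff -> : count (fun j : 'I_n => a j) (take i (enum 'I_n)) = count a (iota 0 i).
  by rewrite ltnn subnn.
rewrite -(count_map val a) map_take val_enum_ord take_iota.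
by rewrite (minn_idPl (ltnW lt_i)).
Qed.

Lemma count_filter_ord_lt (a : pred nat) (i : 'I_n) : a i ->
  count a (iota 0 i) < size [seq j : 'I_n <- enum 'I_n | a j].
Proof.
move=> ai; rewrite size_filter -(count_map val a) val_enum_ord.
rewrite -[X in _ < count a (iota 0 X)](subnKC (ltn_ord i)) addSn -addnS iotaD count_cat /= ai; lia.
Qed.

Lemma perm_of_jumpsE (w : 'S_n) :
    [seq (w i).+1 | i <- J] = iota 1 q ->
    [seq (w i).+1 | i <- N] = iota q.+1 q ->
  forall i : 'I_n, w i = (if p i then count p (iota 0 i)
                          else q + count (predC p) (iota 0 i)) :> nat.
Proof.
move=> wJ wN i; apply: succn_inj.
have sz a s : [seq (w i).+1 | i <- s] = iota a q -> size s = q.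
  by move/(congr1 size); rewrite size_map size_iota.
case: (boolP (p i)) => pi.
  have lt_i := count_filter_ord_lt pi.
  by rewrite -{1}(nth_filter_ord pi) -(nth_map i 0 (fun i => (w i).+1)) // wJ nth_iota -?(sz _ _ wJ).
have lt_i := count_filter_ord_lt (pi : predC p i).
rewrite -{1}(nth_filter_ord (pi : predC p i)).
by rewrite -(nth_map i 0 (fun i => (w i).+1)) // wN nth_iota -?(sz _ _ wN).
Qed.

(** The witness sends [i] to its index in the list of all jumps followed by all non-jumps. *)
Lemma exists_perm_of_jumps : n = 2 * q -> count p (iota 0 n) = q ->
  exists w : 'S_n, [seq (w i).+1 | i <- J] = iota 1 q
                /\ [seq (w i).+1 | i <- N] = iota q.+1 q.
Proof.
move=> nE cJ; pose s := J ++ N.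
have s_perm : perm_eq s (enum 'I_n) by rewrite perm_filterC.
have s_uniq : uniq s by rewrite (perm_uniq s_perm) enum_uniq.
have s_mem i : i \in s by rewrite (perm_mem s_perm) mem_enum.
have s_size : size s = n by rewrite (perm_size s_perm) size_enum_ord.
have szJ : size J = q.
  by rewrite size_filter -(count_map val p) val_enum_ord.
have lt_idx i : index i s < n by have := s_mem i; rewrite -index_mem s_size.
have w_inj : injective (fun i => Ordinal (lt_idx i)).
  by move=> i j /(congr1 val)/= /(congr1 (nth i s)); rewrite !nth_index.
exists (perm w_inj).
have wE : [seq (perm w_inj i).+1 | i <- s] = iota 1 n.
  apply: (@eq_from_nth _ 0); rewrite ?size_map ?size_iota // s_size => j lt_j.
  rewrite (nth_map (Ordinal lt_j)) ?s_size // nth_iota // permE /=.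
  by rewrite index_uniq ?s_size.
have iotaE : iota 1 n = iota 1 q ++ iota q.+1 q by rewrite nE mul2n -addnn iotaD.
move: wE; rewrite map_cat iotaE.
by move/eqP; rewrite eqseq_cat ?size_map ?size_iota // => /andP[/eqP-> /eqP->].
Qed.

End PermOfJumps.

Lemma count_jump q h : unit_steps q h -> forall j, j <= 2 * q ->
  count (jump h) (iota 0 j) = h j /\ count (predC (jump h)) (iota 0 j) = j - h j.
Proof.
move=> ush; have [h0 _ st] := ush; elim=> [|j IHj] lt_j; first by rewrite h0.
have [IH1 IH2] := IHj (ltnW lt_j).
rewrite -addn1 iotaD !count_cat IH1 IH2 add0n addn1 /= /jump.
by have := st j lt_j; have := unit_steps_le ush (ltnW lt_j); case: eqP; lia.
Qed.

(** * Final filtrations and the uniqueness of eta *)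

Section FinalFiltrations.

Variables (p : nat) (k : closedFieldType) (charkp : p \in [pchar k]%R).
Variables (D : dieudonneModule charkp) (q : nat).

Definition flag (W : nat -> {vspace D}) : Prop :=
  [/\ W 0 = 0%VS, W (2 * q) = fullv,
      forall j, j < 2 * q -> (W j <= W j.+1)%VS
    & forall j, j <= 2 * q -> \dim (W j) = j].

Lemma eta_unit_steps W K : flag W -> \dim K = q -> unit_steps q (Defs.eta W K).
Proof.
case=> W0 W2q Wle dimW dimK; split=> [||j lt_j].
- by rewrite /Defs.eta W0 cap0v dimv0.
- by rewrite /Defs.eta W2q capfv.
have leK : (W j :&: K <= W j.+1 :&: K)%VS by rewrite capvS ?Wle.
(* For the upper bound, [W_j + (W_{j+1} :&: K)] lies in [W_{j+1}], and its two summands meet in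
   [W_j :&: K]. *)
rewrite /Defs.eta dimvS //= -(leq_add2l (\dim (W j))) addnS [\dim (W j) + _]addnC.
rewrite -dimv_sum_cap -capvA [(K :&: _)%VS]capvC capvA (capv_idPr (Wle j lt_j)).
rewrite addnC [\dim (W j) + _]addnC -addnS leq_add2l (dimW _ (ltnW lt_j)).
by rewrite -[leqRHS](dimW _ lt_j) dimvS // subv_add capvSl Wle.
Qed.

Lemma final_flag W : final_filtration q W -> flag W.
Proof. by case=> -[]. Qed.

Section KernelOfF.

Variable K : {vspace D}.
Hypotheses (kerK : is_kerF K) (dimK : \dim K = q).
Hypothesis imV : forall x : D, dm_F D x = 0%R <-> exists y : D, x = dm_V D y.

(** Rank-nullity for [F] on [W_j] leaves a single possible index for the image. *)
Lemma final_F W : final_filtration q W -> forall j, j <= 2 * q ->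
  forall x, x \in W (j - Defs.eta W K j) <-> exists2 y, y \in W j & x = dm_F D y.
Proof.
case=> _ _ dimW closF _ j le_j; have [i le_i Wi] := closF j le_j.
have := semilinear_dim (rmorph0 (pFrobenius_aut charkp))
  (frobenius_invK charkp) (raddfD (dm_F D)) (linearZ_LR (dm_F D)) kerK Wi.
rewrite !dimW // => dimE.
by have -> : j - Defs.eta W K j = i by rewrite /Defs.eta; lia.
Qed.

(** [Ker V = V^-1(W_0)] is a member of the flag, of dimension [q] since [V] maps the
    [2q]-dimensional [D] onto [Ker F]. Then [V] maps [V^-1(W_j)] onto [W_j :&: Ker F], which fixes
    the dimension of the preimage. *)
Lemma final_V W : final_filtration q W -> forall j, j <= 2 * q ->
  forall x, x \in W (q + Defs.eta W K j) <-> dm_V D x \in W j.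
Proof.
case=> [[W0 W2q] _ dimW _ closV] j le_j.
have semV := semilinear_dim (rmorph0 (frobenius_inv charkp))
  (frobeniusK charkp) (raddfD (dm_V D)) (linearZ_LR (dm_V D)).
have [l le_l Wl] := closV 0 (leq0n _); have [i le_i Wi] := closV j le_j.
have kerV x : x \in W l <-> dm_V D x = 0%R.
  split=> [/Wl|Vx0]; first by rewrite W0 memv0 => /eqP.
  by apply/Wl; rewrite Vx0 mem0v.
have lE : l = q.
  have imK x : x \in K <-> exists2 y, y \in fullv & x = dm_V D y.
    split=> [/kerK/imV[y ->]|[y _ ->]]; first by exists y => //; rewrite memvf.
    by apply/kerK/imV; exists y.
  have := semV _ _ _ kerV imK; rewrite dimK capvC -W2q W2q capvf dimW // -W2q dimW //. lia.
have leW : (W l <= W i)%VS.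
  by apply/subvP => x /kerV Vx0; apply/Wi; rewrite Vx0 mem0v.
have := semV (W i) (W l) (W j :&: K)%VS kerV.
rewrite (capv_idPr leW) !dimW // lE => dimE.
suff -> : q + Defs.eta W K j = i by [].
apply: dimE => x; rewrite memv_cap; split=> [/andP[Wx /kerK/imV[y xE]]|[y /Wi Wy ->]].
  by exists y => //; apply/Wi; rewrite -xE.
by rewrite Wy; apply/kerK/imV; exists y.
Qed.

Lemma eta_final_unique W W' : final_filtration q W -> final_filtration q W' ->
  forall j, j <= 2 * q -> Defs.eta W K j = Defs.eta W' K j.
Proof.
move=> finW finW'; have flW := final_flag finW; have flW' := final_flag finW'.
have [W0 W2q _ _] := flW; have [W'0 W'2q _ _] := flW'.
have ush := eta_unit_steps flW dimK; have ush' := eta_unit_steps flW' dimK.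
have etaE s : W s = W' s -> Defs.eta W' K s = Defs.eta W K s by rewrite /Defs.eta => ->.
have cl : step_closed q (Defs.eta W K) (fun j => W j == W' j).
  move=> s le_s /eqP eqW; split; apply/eqP/vspaceP => x; apply/idP/idP.
  - by move/(final_F finW le_s); rewrite eqW -(etaE s) // => /(final_F finW' le_s).
  - by rewrite -(etaE s) // => /(final_F finW' le_s); rewrite -eqW (etaE s) // => /(final_F finW le_s).
  - by move/(final_V finW le_s); rewrite eqW -(etaE s) // => /(final_V finW' le_s).
  by rewrite -(etaE s) // => /(final_V finW' le_s); rewrite -eqW (etaE s) // => /(final_V finW le_s).
apply: (unit_steps_eq (S := fun j => W j == W' j)) => //.
- by rewrite W0 W'0.
- by rewrite W2q W'2q.
- by move=> s le_s Ss; rewrite (etaE s (eqP Ss)); apply: cl.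
by move=> s _ /eqP/etaE.
Qed.

Lemma siegel_EO_perm_exists (W : nat -> {vspace D}) : final_filtration q W ->
  exists w : 'S_(2 * q), siegel_EO_perm D w.
Proof.
move=> finW; have ush := eta_unit_steps (final_flag finW) dimK.
have [cJ _] := count_jump ush (leqnn _); have [_ h2q _] := ush; rewrite h2q in cJ.
by have [w [wJ wN]] := exists_perm_of_jumps erefl cJ; exists w, W, K.
Qed.

(** The filtration hidden in [siegel_EO_perm] is arbitrary; [eta_final_unique] trades its [eta] for
    that of the one explicit filtration [W]. *)
Lemma siegel_EO_permE (W : nat -> {vspace D}) (w : 'S_(2 * q)) : final_filtration q W ->
    siegel_EO_perm D w -> let h := Defs.eta W K in
  forall i : 'I_(2 * q), w i = (if jump h i then h i else q + (i - h i)) :> nat.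
Proof.
move=> finW [W' [K' [finW' [kerK' _] wJ wN]]] h i.
have eqK : K' = K.
  by apply/vspaceP => x; apply/idP/idP => [/kerK'/kerK|/kerK/kerK'].
rewrite {K' kerK'}eqK in wJ wN.
have ush' := eta_unit_steps (final_flag finW') dimK.
have [c1 c2] := count_jump ush' (ltnW (ltn_ord i)).
rewrite (perm_of_jumpsE (p := jump (Defs.eta W' K)) wJ wN) c1 c2 /jump /h.
by rewrite !(eta_final_unique finW finW') // ltnW.
Qed.

End KernelOfF.

End FinalFiltrations.

(** * Coordinate subspaces *)

(** [V] is [U] plus the line of [b]; in every use [l] is the coordinate along [b]. *)
Lemma dim_step (k : fieldType) (vT : vectType k) (U V : {vspace vT}) (b : vT)
    (l : vT -> k) :
    (U <= V)%VS -> b \in V -> b \notin U ->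
    (forall x, x \in V -> (x - l x *: b)%R \in U) ->
  \dim V = (\dim U).+1.
Proof.
move=> leUV Vb nUb Vl.
have -> : V = (U + <[b]>)%VS.
  apply/eqP; rewrite eqEsubv subv_add leUV -memvE Vb !andbT.
  apply/subvP => x /Vl Ux; apply/memv_addP; exists (x - l x *: b)%R => //.
  by exists (l x *: b)%R; rewrite ?subrK // rpredZ ?memv_line.
rewrite dimv_disjoint_sum ?dim_vline.
  by case: eqP nUb => [->|]; rewrite ?mem0v ?addn1.
apply/eqP; rewrite -subv0; apply/subvP => x; rewrite memv_cap => /andP[Ux /vlineP[c xE]].
case: (eqVneq c 0%R) => [c0|nc]; first by rewrite xE c0 scale0r mem0v.
case/negP: nUb; rewrite -[b](scalerK nc) -xE; exact: rpredZ.
Qed.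

Section Coordinates.

Variables (k : fieldType) (q : nat).
Local Notation M := 'M[k]_(2, q).

(** Out-of-range indices get the value 0, so that index maps such as [srcF], which may leave the
    range below [q], cause no side conditions. *)
Definition coord_at (x : M) (r : 'I_2) (j : nat) : k :=
  if insub j is Some i then x r i else 0%R.

Definition of_coords (f : 'I_2 -> nat -> k) : M := (\matrix_(r, i) f r i)%R.

Lemma coord_at_ord x r (i : 'I_q) : coord_at x r i = x r i.
Proof. by rewrite /coord_at valK. Qed.

Lemma coord_at_ge x r j : q <= j -> coord_at x r j = 0%R.
Proof. by move=> le_qj; rewrite /coord_at insubN // -leqNgt. Qed.

Lemma coord_at_of f r j : coord_at (of_coords f) r j = if j < q then f r j else 0%R.
Proof.
case: ltnP => [lt_j|/coord_at_ge -> //].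
by rewrite (coord_at_ord _ r (Ordinal lt_j)) mxE.
Qed.

Lemma ord2P (P : 'I_2 -> Prop) : P 0%R -> P 1%R -> forall r, P r.
Proof.
move=> P0 P1 [[|[|//]] lt_r]; first by congr (P _): P0; apply: val_inj.
by congr (P _): P1; apply: val_inj.
Qed.

Lemma coord_at_inj x y : (forall j, coord_at x 0%R j = coord_at y 0%R j) ->
  (forall j, coord_at x 1%R j = coord_at y 1%R j) -> x = y.
Proof.
move=> eq0 eq1; apply/matrixP => r i; rewrite -!coord_at_ord.
by elim/ord2P: r.
Qed.

Lemma coord_atD x y r j : coord_at (x + y)%R r j = (coord_at x r j + coord_at y r j)%R.
Proof. by rewrite /coord_at; case: insub => [i|]; rewrite ?mxE ?addr0. Qed.

Lemma coord_atZ a x r j : coord_at (a *: x)%R r j = (a * coord_at x r j)%R.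
Proof. by rewrite /coord_at; case: insub => [i|]; rewrite ?mxE ?mulr0. Qed.

Lemma coord_atN x r j : coord_at (- x)%R r j = (- coord_at x r j)%R.
Proof. by rewrite -scaleN1r coord_atZ mulN1r. Qed.

Lemma coord_at0 r j : coord_at 0%R r j = 0%R.
Proof. by rewrite -(scale0r 0%R) coord_atZ mul0r. Qed.

Lemma sum_coord_at (s : k -> k) (x : M) r j : s 0%R = 0%R ->
  (\sum_(b < q) s (x r b) * (b == j :> nat)%:R = s (coord_at x r j))%R.
Proof.
move=> s0; case: (ltnP j q) => [lt_j|ge_j].
  rewrite (bigD1 (Ordinal lt_j)) //= eqxx mulr1 big1 ?addr0.
    by rewrite -(coord_at_ord x r (Ordinal lt_j)).
  by move=> b; rewrite -val_eqE => /negbTE/= ->; rewrite mulr0.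
rewrite coord_at_ge // s0 big1 // => b _.
by rewrite (_ : (_ == j) = false) ?mulr0 //; have := ltn_ord b; lia.
Qed.

Definition mask (P0 P1 : pred nat) (x : M) : M :=
  of_coords (fun r j => if (if r == 0%R then P0 j else P1 j) then 0%R
                        else coord_at x r j).

Fact mask_is_linear P0 P1 : linear (mask P0 P1).
Proof.
move=> a x y; apply/matrixP => r i; rewrite !mxE.
by case: ifP => _; rewrite ?coord_atD ?coord_atZ ?mulr0 ?addr0.
Qed.

HB.instance Definition _ P0 P1 :=
  GRing.isLinear.Build k M M *:%R (mask P0 P1) (mask_is_linear P0 P1).

Definition coord_space (P0 P1 : pred nat) : {vspace M} := lker (linfun (mask P0 P1)).

Lemma mem_coord_space P0 P1 x : reflect
  ((forall j, ~~ P0 j -> coord_at x 0%R j = 0%R)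
   /\ (forall j, ~~ P1 j -> coord_at x 1%R j = 0%R))
  (x \in coord_space P0 P1).
Proof.
rewrite memv_ker lfunE /=; apply: (iffP eqP) => [m0|[x0 x1]].
  split=> j /negbTE Pj; case: (ltnP j q) => [lt_j|/coord_at_ge //].
    by have := congr1 (fun z => coord_at z 0%R j) m0;
      rewrite coord_at_of lt_j coord_at0 /= Pj.
  by have := congr1 (fun z => coord_at z 1%R j) m0;
    rewrite coord_at_of lt_j coord_at0 /= Pj.
apply: coord_at_inj => j; rewrite coord_at_of coord_at0 /=; case: ifP => // _.
  by case: ifPn => // /x0.
by case: ifPn => // /x1.
Qed.

Definition unit_vec (r : 'I_2) (j : nat) : M := of_coords (fun r' j' => ((r' == r) && (j' == j))%:R)%R.

Lemma coord_at_unit r j r' j' : j < q ->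
  coord_at (unit_vec r j) r' j' = ((r' == r) && (j' == j))%:R%R.
Proof.
move=> lt_j; rewrite coord_at_of; case: ltnP => // ge_j'.
by rewrite (_ : (j' == j) = false) ?andbF //; lia.
Qed.

Lemma coord_space_eq P0 P1 Q0 Q1 : P0 =1 Q0 -> P1 =1 Q1 ->
  coord_space P0 P1 = coord_space Q0 Q1.
Proof.
move=> e0 e1; apply/vspaceP => x; apply/mem_coord_space/mem_coord_space.
  by case=> x0 x1; split=> j; rewrite -?e0 -?e1; [apply: x0 | apply: x1].
by case=> x0 x1; split=> j; rewrite ?e0 ?e1; [apply: x0 | apply: x1].
Qed.

Definition below (P : pred nat) (a : nat) : pred nat := fun j => P j && (j < a).

Lemma dim_coord_space_S0 P0 P1 a : a < q ->
  \dim (coord_space (below P0 a.+1) P1) = P0 a + \dim (coord_space (below P0 a) P1).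
Proof.
move=> lt_a; case: (boolP (P0 a)) => Pa; last first.
  congr (\dim _); apply: coord_space_eq => // j; rewrite /below ltnS leq_eqVlt.
  by case: eqP => [->|//]; rewrite (negbTE Pa).
apply: (dim_step (b := unit_vec 0%R a) (l := fun x => coord_at x 0%R a)).
- apply/subvP => x /mem_coord_space[x0 x1]; apply/mem_coord_space; split=> // j nj.
  by apply: x0; apply: contra nj => /andP[Pj lt_j]; rewrite /below Pj ltnW.
- apply/mem_coord_space; split=> j; rewrite coord_at_unit //= /below.
  by case: eqP => // ->; rewrite Pa ltnSn.
- apply/mem_coord_space => -[/(_ a)]; rewrite /below ltnn andbF coord_at_unit // !eqxx.
  by move/(_ isT)/eqP; rewrite oner_eq0.
move=> x /mem_coord_space[x0 x1]; apply/mem_coord_space.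
split=> j; rewrite coord_atD coord_atN coord_atZ coord_at_unit //=; last first.
  by move=> /x1 ->; rewrite mulr0 subr0.
case: eqP => [-> _|]; first by rewrite mulr1 subrr.
rewrite mulr0 subr0 => nj; rewrite /below => nPj; apply: x0; apply: contra nPj.
by rewrite /below ltnS leq_eqVlt; case: eqP nj.
Qed.

Lemma dim_coord_space_S1 P0 P1 a : a < q ->
  \dim (coord_space P0 (below P1 a.+1)) = P1 a + \dim (coord_space P0 (below P1 a)).
Proof.
move=> lt_a; case: (boolP (P1 a)) => Pa; last first.
  congr (\dim _); apply: coord_space_eq => // j; rewrite /below ltnS leq_eqVlt.
  by case: eqP => [->|//]; rewrite (negbTE Pa).
apply: (dim_step (b := unit_vec 1%R a) (l := fun x => coord_at x 1%R a)).
- apply/subvP => x /mem_coord_space[x0 x1]; apply/mem_coord_space; split=> // j nj.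
  by apply: x1; apply: contra nj => /andP[Pj lt_j]; rewrite /below Pj ltnW.
- apply/mem_coord_space; split=> j; rewrite coord_at_unit //= /below.
  by case: eqP => // ->; rewrite Pa ltnSn.
- apply/mem_coord_space => -[_ /(_ a)]; rewrite /below ltnn andbF coord_at_unit // !eqxx.
  by move/(_ isT)/eqP; rewrite oner_eq0.
move=> x /mem_coord_space[x0 x1]; apply/mem_coord_space.
split=> j; rewrite coord_atD coord_atN coord_atZ coord_at_unit //=.
  by move=> /x0 ->; rewrite mulr0 subr0.
case: eqP => [-> _|]; first by rewrite mulr1 subrr.
rewrite mulr0 subr0 => nj; rewrite /below => nPj; apply: x1; apply: contra nPj.
by rewrite /below ltnS leq_eqVlt; case: eqP nj.
Qed.

Lemma dim_coord_space P0 P1 a b : a <= q -> b <= q ->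
  \dim (coord_space (below P0 a) (below P1 b))
    = count P0 (iota 0 a) + count P1 (iota 0 b).
Proof.
elim: a => [|a IHa] le_a.
  elim: b => [|b IHb] le_b.
    apply/eqP; rewrite dimv_eq0 -subv0; apply/subvP => x /mem_coord_space[x0 x1].
    rewrite memv0; apply/eqP/coord_at_inj => j; rewrite coord_at0 ?x0 ?x1 //.
    - by rewrite /below ltn0 andbF.
    by rewrite /below ltn0 andbF.
  rewrite dim_coord_space_S1 // IHb ?(ltnW le_b) //.
  by rewrite -[b.+1]addn1 iotaD count_cat /= addn0 addnC.
move=> le_b; rewrite dim_coord_space_S0 // IHa ?(ltnW le_a) //.
by rewrite -[a.+1]addn1 iotaD count_cat /= addn0 addnCA addnA.
Qed.

(* In the notation of the paper: the span of e_{1,1}, ..., e_{1,a} and of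
   e_{2,1}, ..., e_{2,b}, plus e_{1,a+1} + e_{2,b+1} if d holds. *)
Definition state_space (a b : nat) (d : bool) : {vspace M} :=
  let U := coord_space (below predT a) (below predT b) in
  if d then (U + <[unit_vec 0%R a + unit_vec 1%R b]>)%VS else U.

(** Read as a number, [d] raises both vanishing thresholds by one to make room for the diagonal
    vector, whose two coordinates are then tied. *)
Lemma mem_state_space a b (d : bool) x : (d -> a < q /\ b < q) -> reflect
  [/\ forall j, a + d <= j -> coord_at x 0%R j = 0%R,
      forall j, b + d <= j -> coord_at x 1%R j = 0%R
    & d -> coord_at x 0%R a = coord_at x 1%R b]
  (x \in state_space a b d).
Proof.
case: d => [[//|lt_a lt_b]|_]; rewrite /state_space; last first.
  rewrite !addn0; apply: (iffP (mem_coord_space _ _ _)) => [[x0 x1]|[x0 x1 _]]; split=> // j.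
  - by rewrite leqNgt => ?; apply: x0.
  - by rewrite leqNgt => ?; apply: x1.
  - by rewrite /below /= -leqNgt; apply: x0.
  by rewrite /below /= -leqNgt; apply: x1.
rewrite !addn1.
apply: (iffP (memv_addP)) => [[y /mem_coord_space[y0 y1] [_ /vlineP[c ->] ->]]|[x0 x1 /(_ isT) xd]].
  split=> [j lt_j|j lt_j|_]; rewrite !(coord_atD, coord_atZ) !coord_at_unit //= ?eqxx ?add0r ?addr0.
  - rewrite y0 /below /= -?leqNgt ?(ltnW lt_j) //.
    by rewrite (_ : (j == a) = false) ?mulr0 ?addr0 //; lia.
  - rewrite y1 /below /= -?leqNgt ?(ltnW lt_j) //.
    by rewrite (_ : (j == b) = false) ?mulr0 ?addr0 //; lia.
  by rewrite y0 ?y1 // /below /= ltnn.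
set e := (_ + _)%R in x0 x1 xd *.
exists (x - coord_at x 0%R a *: e)%R; last first.
  by exists (coord_at x 0%R a *: e)%R; rewrite ?subrK // rpredZ ?memv_line.
apply/mem_coord_space; split=> j; rewrite /below /= -leqNgt leq_eqVlt;
  rewrite !(coord_atD, coord_atN, coord_atZ) !coord_at_unit //= ?add0r ?addr0.
  by case: eqP => [<- _|_ lt_j]; rewrite ?eqxx ?mulr1 ?subrr // x0 // gtn_eqF // mulr0 subr0.
by case: eqP => [<- _|_ lt_j]; rewrite ?eqxx ?mulr1 ?xd ?subrr // x1 // gtn_eqF // mulr0 subr0.
Qed.

End Coordinates.

(** * The standard module *)

Section Indices.

Variables (q u v : nat).
Hypotheses (hu : 0 < u) (huv : u < v) (hv : v <= q).

(* With 0-based j: e_{2,j} is the image under F of e_{1,srcF j}, and the image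
   under V of e_{1,srcV j} unless j = q - v or j = q - u. *)
Definition srcF (j : nat) : nat := if j.+1 < u then j else if j.+2 < v then j.+1 else j.+2.
Definition srcV (j : nat) : nat := if j <= q - v then j.+2 else if j <= q - u then j.+1 else j.
(** The subtracted term counts the vectors of [Ker F] among the first [j] of row one, so [tgtF j] is
    also the dimension of the image under [F] of their span. *)
Definition tgtF (j : nat) : nat := j - ((u <= j) + (v <= j)).
Definition tgtV (j : nat) : nat := if j <= q - v + 1 then j - 2 else if j <= q - u then j - 1 else j.

(* Ker F is spanned by the e_{1,j} with kerF1 j and the e_{2,j} with kerF2 j. *)
Definition kerF1 : pred nat := fun j => (j == u - 1) || (j == v - 1).
Definition kerF2 : pred nat := fun j => (j != q - v) && (j != q - u).

Lemma srcFK j : ~~ kerF1 j -> srcF (tgtF j) = j.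
Proof. by rewrite /kerF1 /srcF /tgtF; do ![case: ifP => ?]; lia. Qed.

Lemma srcF_nker j : ~~ kerF1 (srcF j).
Proof. by rewrite /kerF1 /srcF; do ![case: ifP => ?]; lia. Qed.

Lemma tgtFK j : tgtF (srcF j) = j.
Proof. by rewrite /tgtF /srcF; do ![case: ifP => ?]; lia. Qed.

Lemma tgtVK j : kerF2 j -> j < q -> tgtV (srcV j) = j.
Proof. by rewrite /kerF2 /srcV; do ![case: ifP => ?]; rewrite /tgtV; do ![case: ifP => ?]; lia. Qed.

Lemma srcVK j : 1 < j -> srcV (tgtV j) = j.
Proof. by rewrite /tgtV; do ![case: ifP => ?]; rewrite /srcV; do ![case: ifP => ?]; lia. Qed.

Lemma tgtV_ker j : 1 < j -> j < q -> kerF2 (tgtV j).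
Proof. by rewrite /kerF2 /tgtV; do ![case: ifP => ?]; lia. Qed.

Local Notation f a := ((u <= a) + (v <= a)).
Local Notation g b := ((q - v < b) + (q - u < b)).

(** [f a] counts the first [a] vectors of row one inside [Ker F], and [g b] the first [b] of row two
    outside it. So [F] turns the thresholds [(a, b)] into [(g b, a - f a)], and [V^-1] into
    [(b + 2 - g b, q - 2 + f a)], where 2 and [q - 2] come from [Ker V]. The terms in [d] record
    whether a diagonal vector survives. *)
Lemma tgtF_ge a j (d : bool) : a + d <= j -> ~~ kerF1 j ->
  a - f a + (d && ~~ kerF1 a) <= tgtF j.
Proof.
move=> le_j /srcFK srcE; move: le_j; rewrite -{1}srcE {srcE}; move: (tgtF j) => m.
rewrite /kerF1 /srcF.
by case: d => /=; case: (ltngtP a (u - 1)) => ?; case: (ltngtP a (v - 1)) => ? /=;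
  do ![case: ifP => ?]; lia.
Qed.

Lemma srcF_ge a j (d : bool) : a - f a + (d && ~~ kerF1 a) <= j ->
  a + d <= srcF j.
Proof.
rewrite /kerF1 /srcF.
by case: d => /=; case: (ltngtP a (u - 1)) => ?; case: (ltngtP a (v - 1)) => ? /=;
  do ![case: ifP => ?]; lia.
Qed.

Lemma tgtV_ge b j (d : bool) : b + 2 - g b + (d && kerF2 b) <= j -> b <= q ->
  b + d <= tgtV j.
Proof.
rewrite /kerF2 /tgtV.
by case: d => /=; case: (ltngtP b (q - v)) => ?; case: (ltngtP b (q - u)) => ? /=;
  do ![case: ifP => ?]; lia.
Qed.

Lemma srcV_ge b j (d : bool) : b + d <= j -> kerF2 j ->
  b + 2 - g b + (d && kerF2 b) <= srcV j.
Proof.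
rewrite /kerF2 /srcV => le_j /andP[nv nu].
by case: d le_j => /=; case: (ltngtP b (q - v)) => ?; case: (ltngtP b (q - u)) => ? /=;
  do ![case: ifP => ?]; lia.
Qed.

(** Coordinates 0 and 1 of row one of [F x] come from coordinates [q - v] and [q - u] of row two of
    [x]; their vanishing conditions have to correspond. *)
Lemma below_kerF2 b (d : bool) :
  ((g b + (d && ~~ kerF2 b) <= 0) = (b + d <= q - v))
  * ((g b + (d && ~~ kerF2 b) <= 1) = (b + d <= q - u)).
Proof.
rewrite /kerF2.
by split; case: d => /=; case: (ltngtP b (q - v)) => ?; case: (ltngtP b (q - u)) => ? /=; lia.
Qed.

Lemma below_kerF2_le2 b (d : bool) : g b + (d && ~~ kerF2 b) <= 2.
Proof.
rewrite /kerF2.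
by case: d => /=; case: (ltngtP b (q - v)) => ?; case: (ltngtP b (q - u)) => ? /=; lia.
Qed.

(** The analogue for [V]: coordinates [u - 1] and [v - 1] of row one of [V x] come from coordinates
    [q - 2] and [q - 1] of row two of [x]. *)
Lemma below_kerF1 a (d : bool) :
  ((q - 2 + f a + (d && kerF1 a) <= q - 2) = (a + d <= u - 1))
  * ((q - 2 + f a + (d && kerF1 a) <= q - 1) = (a + d <= v - 1)).
Proof.
rewrite /kerF1.
by split; case: d => /=; case: (ltngtP a (u - 1)) => ?; case: (ltngtP a (v - 1)) => ? /=; lia.
Qed.

Lemma srcV_kerF2 b : kerF2 b -> srcV b = b + 2 - g b.
Proof.
rewrite /kerF2 /srcV => /andP[? ?].
by case: (ltngtP b (q - v)) => ?; case: (ltngtP b (q - u)) => ? /=; lia.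
Qed.

Lemma rank_kerF1 : (q - 2 + f (u - 1) = q - 2) * (q - 2 + f (v - 1) = q - 1).
Proof. by split; lia. Qed.

End Indices.

Section StandardModule.

Variables (p : nat) (k : closedFieldType) (charkp : p \in [pchar k]%R).
Variables (q u v : nat).
Hypotheses (hu : 0 < u) (huv : u < v) (hv : v <= q).

Local Notation M := 'M[k]_(2, q).
Local Notation phi := (pFrobenius_aut charkp).
Local Notation psi := (frobenius_inv charkp).
Local Notation F := (std_F charkp u v).
Local Notation V := (std_V charkp u v).
Local Notation "x .0_ j" := (coord_at x 0%R j) (at level 2, format "x .0_ j").
Local Notation "x .1_ j" := (coord_at x 1%R j) (at level 2, format "x .1_ j").

Lemma eqb_natr (a b : bool) : a = b -> a%:R%R = b%:R%R :> k.
Proof. by move->. Qed.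

Lemma eqb_natr0 (b : bool) : b = false -> 0%R = b%:R%R :> k.
Proof. by move->. Qed.

Lemma coord_F0 (x : M) j : (F x).0_j =
  if j == 0 then phi x.1_(q - v) else if j == 1 then phi x.1_(q - u) else 0%R.
Proof.
case: (ltnP j q) => [lt_j|ge_j]; last first.
  rewrite coord_at_ge //; do 2![case: eqP => [?|_]; first lia]; done.
rewrite (coord_at_ord _ _ (Ordinal lt_j)) /std_F summxE.
transitivity (\sum_(b < q) phi (x 1 b) * (std_F2 k q u v b.+1) 0%R (Ordinal lt_j))%R.
  apply: eq_bigr => b _; rewrite !mxE (_ : std_F1 _ _ _ _ _ _ _ = 0%R) ?mulr0 ?add0r //.
  by rewrite /std_F1; do ![case: ifP => _]; rewrite mxE.
have F2E b : std_F2 k q u v b.+1 0%R (Ordinal lt_j) =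
    ((j == 0) && (b == q - v) || (j == 1) && (b == q - u))%N%:R%R.
  by rewrite /std_F2; do ![case: ifP => ?]; rewrite mxE; (apply: eqb_natr || apply: eqb_natr0) => /=; lia.
under eq_bigr do rewrite F2E.
case: eqP => [->|_] /=; last case: eqP => [_|_] /=.
- rewrite -(sum_coord_at x 1%R (q - v) (rmorph0 phi)).
  by apply: eq_bigr => b _; rewrite orbF.
- exact: sum_coord_at (rmorph0 phi).
by rewrite big1 // => b _; rewrite mulr0.
Qed.

Lemma coord_F1 (x : M) j : (F x).1_j = phi x.0_(srcF u v j).
Proof.
case: (ltnP j q) => [lt_j|ge_j]; last first.
  rewrite coord_at_ge // coord_at_ge ?rmorph0 //.
  by rewrite /srcF; do ![case: ifP => ?]; lia.
rewrite (coord_at_ord _ _ (Ordinal lt_j)) /std_F summxE.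
rewrite -(sum_coord_at x 0%R (srcF u v j) (rmorph0 phi)).
apply: eq_bigr => b _; rewrite !mxE (_ : std_F2 _ _ _ _ _ _ _ = 0%R) ?mulr0 ?addr0; last first.
  by rewrite /std_F2; do ![case: ifP => _]; rewrite mxE.
congr (_ * _)%R; have lt_b := ltn_ord b.
by rewrite /std_F1 /srcF; do ![case: ifP => ?]; rewrite mxE; (apply: eqb_natr || apply: eqb_natr0) => /=; lia.
Qed.

Lemma coord_V0 (x : M) j : (V x).0_j =
  if j == u - 1 then psi x.1_(q - 2) else if j == v - 1 then psi x.1_(q - 1) else 0%R.
Proof.
case: (ltnP j q) => [lt_j|ge_j]; last first.
  rewrite coord_at_ge //; do 2![case: eqP => [?|_]; first lia]; done.
rewrite (coord_at_ord _ _ (Ordinal lt_j)) /std_V summxE.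
transitivity (\sum_(b < q) psi (x 1 b) * (std_V2 k q u v b.+1) 0%R (Ordinal lt_j))%R.
  apply: eq_bigr => b _; rewrite !mxE (_ : std_V1 _ _ _ _ _ _ _ = 0%R) ?mulr0 ?add0r //.
  by rewrite /std_V1; do ![case: ifP => _]; rewrite mxE.
have V2E b : std_V2 k q u v b.+1 0%R (Ordinal lt_j) =
    ((j == u - 1) && (b == q - 2) || (j == v - 1) && (b == q - 1))%N%:R%R.
  by rewrite /std_V2; do ![case: ifP => ?]; rewrite mxE; (apply: eqb_natr || apply: eqb_natr0) => /=; lia.
under eq_bigr do rewrite V2E.
case: eqP => [ju|_] /=; last case: eqP => [_|_] /=.
- rewrite -(sum_coord_at x 1%R (q - 2) (rmorph0 psi)).
  by apply: eq_bigr => b _; rewrite (_ : (j == v - 1) = false) ?orbF //; lia.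
- exact: sum_coord_at (rmorph0 psi).
by rewrite big1 // => b _; rewrite mulr0.
Qed.

Lemma coord_V1 (x : M) j : (V x).1_j = if kerF2 q u v j then psi x.0_(srcV q u v j) else 0%R.
Proof.
case: (ltnP j q) => [lt_j|ge_j]; last first.
  rewrite coord_at_ge // coord_at_ge ?rmorph0 ?if_same //.
  by rewrite /srcV; do ![case: ifP => ?]; lia.
rewrite (coord_at_ord _ _ (Ordinal lt_j)) /std_V summxE.
transitivity (\sum_(b < q) psi (x 0 b) * (kerF2 q u v j && (b == srcV q u v j :> nat))%:R)%R.
  apply: eq_bigr => b _; rewrite !mxE (_ : std_V2 _ _ _ _ _ _ _ = 0%R) ?mulr0 ?addr0; last first.
    by rewrite /std_V2; do ![case: ifP => _]; rewrite mxE.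
  congr (_ * _)%R; have lt_b := ltn_ord b.
  by rewrite /std_V1 /kerF2 /srcV; do ![case: ifP => ?]; rewrite mxE; (apply: eqb_natr || apply: eqb_natr0) => /=; lia.
case: ifP => _ /=; last by rewrite big1 // => b _; rewrite mulr0.
exact: sum_coord_at (rmorph0 psi).
Qed.

Definition kerF_space : {vspace M} := coord_space k q (kerF1 u v) (kerF2 q u v).

Lemma mem_kerF (x : M) : x \in kerF_space <-> F x = 0%R.
Proof.
split=> [/mem_coord_space[x0 x1]|Fx0].
  apply: coord_at_inj => j; rewrite coord_at0 ?coord_F0 ?coord_F1.
    by rewrite !x1 /kerF2 ?eqxx ?andbF // rmorph0 !if_same.
  by rewrite x0 ?rmorph0 // (srcF_nker hu huv hv).
have phi0 y : phi y = 0%R -> y = 0%R by move/eqP; rewrite fmorph_eq0 => /eqP.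
apply/mem_coord_space; split=> j nj; apply: phi0.
  by rewrite -(srcFK hu huv hv nj) -coord_F1 Fx0 coord_at0.
have /= e0 := coord_F0 x 0; have /= e1 := coord_F0 x 1.
rewrite Fx0 !coord_at0 in e0 e1.
by move: nj; rewrite negb_and !negbK => /orP[]/eqP->.
Qed.

Lemma dim_kerF : \dim kerF_space = q.
Proof.
have count1 a : count (kerF1 u v) (iota 0 a) = (u <= a) + (v <= a).
  elim: a => [|a IHa]; first by rewrite /=; lia.
  by rewrite -addn1 iotaD count_cat IHa /= /kerF1; lia.
have count2 a : a <= q ->
    count (kerF2 q u v) (iota 0 a) = a - ((q - v < a) + (q - u < a)).
  elim: a => [|a IHa] // lt_a.
  by rewrite -addn1 iotaD count_cat IHa ?(ltnW lt_a) //= /kerF2; lia.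
have -> : kerF_space = coord_space k q (below (kerF1 u v) q) (below (kerF2 q u v) q).
  apply/vspaceP => x; apply/mem_coord_space/mem_coord_space => -[x0 x1]; split=> j.
  - by rewrite negb_and => /orP[/x0 //|]; rewrite -leqNgt => /coord_at_ge.
  - by rewrite negb_and => /orP[/x1 //|]; rewrite -leqNgt => /coord_at_ge.
  - by move=> nj; apply: x0; rewrite negb_and nj.
  by move=> nj; apply: x1; rewrite negb_and nj.
by rewrite dim_coord_space // count1 count2 //; lia.
Qed.

Lemma ker_im_V (x : M) : F x = 0%R <-> exists y, x = V y.
Proof.
split=> [/mem_kerF/mem_coord_space[x0 x1]|[y ->]].
  (* [V] is inverted coordinate by coordinate. Off [q - 2] the second row is constant, since there
     [V] sees only its entry at [q - 1]. *)
  exists (of_coords q (fun r j => if r == 0%R then phi x.1_(tgtV q u v j) else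
     if j == q - 2 then phi x.0_(u - 1) else phi x.0_(v - 1))).
  apply: coord_at_inj => j.
    rewrite coord_V0 !coord_at_of /=.
    case: eqP => [->|ju].
      by case: ltnP => [_|]; [rewrite eqxx frobeniusK | lia].
    case: eqP => [->|jv]; last by rewrite x0 // /kerF1; lia.
    case: ltnP => [_|]; last lia.
    by rewrite ifF ?frobeniusK //; lia.
  rewrite coord_V1 coord_at_of /=; case: ifPn => [kj|/x1 //].
  case: (ltnP j q) => [lt_j|ge_j].
    case: ltnP => [_|]; first by rewrite (tgtVK hu huv hv) // frobeniusK.
    by move: kj; rewrite /kerF2 /srcV; do ![case: ifP => ?]; lia.
  rewrite coord_at_ge // ifF ?rmorph0 //.
  by rewrite /srcV; do ![case: ifP => ?]; lia.
apply/mem_kerF/mem_coord_space; split=> j.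
  by rewrite /kerF1 negb_or coord_V0 => /andP[/negbTE-> /negbTE->].
by rewrite coord_V1 => /negbTE->.
Qed.

End StandardModule.

(** * Action of F and V^-1 on the state spaces *)

Section ClosureOfStates.

Variables (p : nat) (k : closedFieldType) (charkp : p \in [pchar k]%R).
Variables (q u v : nat).
Hypotheses (hu : 0 < u) (huv : u < v) (hv : v <= q).

Local Notation M := 'M[k]_(2, q).
Local Notation phi := (pFrobenius_aut charkp).
Local Notation psi := (frobenius_inv charkp).
Local Notation F := (std_F charkp u v).
Local Notation V := (std_V charkp u v).
Local Notation "x .0_ j" := (coord_at x 0%R j) (at level 2, format "x .0_ j").
Local Notation "x .1_ j" := (coord_at x 1%R j) (at level 2, format "x .1_ j").

Local Notation f a := ((u <= a) + (v <= a)).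
Local Notation g b := ((q - v < b) + (q - u < b)).
Local Notation St := (@state_space k q).

Let neq_tgt : (q - u == q - v) = false. Proof. by lia. Qed.
Let lt_q1 : q - 1 < q. Proof. by lia. Qed.
Let lt_q2 : q - 2 < q. Proof. by lia. Qed.
Let neq_src : (v - 1 == u - 1) = false. Proof. by lia. Qed.
Let between_q j : q - 2 <= j -> j < q -> j != q - 1 -> j = q - 2. Proof. by lia. Qed.
Let leq_sub_g b : b <= q -> 1 < b + 2 - g b. Proof. by lia. Qed.
Let rankV := rank_kerF1 hu huv hv.
Let lt_qv : q - v < q. Proof. by lia. Qed.
Let lt_qu : q - u < q. Proof. by lia. Qed.

(** Frobenius fixes the coefficients 1 of [e_{1,a+1} + e_{2,b+1}], so [F] sends this vector to the
    diagonal vector of the new state or to 0; the equality of [kerF1] and [kerF2] at [a] excludes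
    that only one of its halves is killed. *)
Lemma F_state_space a b (d : bool) :
    a <= q -> b <= q -> (d -> [/\ a < q, a = b & kerF1 u v a = kerF2 q u v a]) ->
    (d && ~~ kerF1 u v a -> g a = a - f a) ->
  forall x, x \in St (g b) (a - f a) (d && ~~ kerF1 u v a)
            <-> exists2 y, y \in St a b d & x = F y.
Proof.
move=> le_a le_b dP dg; set c := d && ~~ kerF1 u v a.
have cE : c = d && ~~ kerF2 q u v b.
  by rewrite /c; case: (d) dP => // /(_ isT)[_ <- ->].
have dP1 : d -> a < q /\ b < q by case/dP=> ? <-.
have cP : c -> [/\ d, ~~ kerF1 u v a & a = b].
  by rewrite /c => /andP[dT nk]; have [_ <-] := dP dT.
have dP2 : c -> g b < q /\ a - f a < q.
  move=> cT; have [dT nk <-] := cP cT; have [lt_a _] := dP1 dT.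
  rewrite dg ?dT //; split; exact: leq_ltn_trans (leq_subr _ _) lt_a.
have b0 : (g b + c <= 0) = (b + d <= q - v) by rewrite cE (below_kerF2 hu huv hv).
have b1 : (g b + c <= 1) = (b + d <= q - u) by rewrite cE (below_kerF2 hu huv hv).
move=> x; split.
  case/(mem_state_space _ dP2) => x0 x1 xd.
  pose y := of_coords q (fun r j => if r == 0%R then
      (if kerF1 u v j then 0%R else psi x.1_(tgtF u v j))
    else if j == q - v then psi x.0_0 else if j == q - u then psi x.0_1 else 0%R) : M.
  exists y.
    apply/(mem_state_space _ dP1); split=> [j le_j|j le_j|dT].
    - rewrite coord_at_of /=; case: ltnP => // _; case: ifPn => // nk.
      by rewrite x1 ?rmorph0 //; apply: (tgtF_ge hu huv hv).
    - rewrite coord_at_of /=; case: ltnP => // _.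
      case: eqP => [jv|_]; last case: eqP => [ju|//].
        by rewrite x0 ?rmorph0 // b0 -jv.
      by rewrite x0 ?rmorph0 // b1 -ju.
    have [lt_a eq_ab kab] := dP dT.
    rewrite !coord_at_of -eq_ab lt_a /=.
    case: (boolP (kerF1 u v a)) => ka.
      by move: ka; rewrite kab /kerF2 => /andP[/negbTE-> /negbTE->].
    have cT : c by rewrite /c dT.
    have gE := dg cT; rewrite /tgtF -(xd cT) -eq_ab gE.
    (* Here [a] is [q - v] or [q - u], and [g a] is 0 or 1 accordingly, so both sides read the same
       coordinate of [x]. *)
    move: ka; rewrite kab /kerF2 negb_and !negbK -gE; case: (a =P q - v) => [->|_ /= /eqP ->].
      by rewrite ltnn ltnNge leq_sub2l // ltnW.
    by rewrite ltnn eqxx ltn_sub2l // (leq_trans huv).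
  apply: coord_at_inj => j.
    rewrite (coord_F0 charkp hu huv hv) // !coord_at_of /=.
    case: eqP => [->|j0]; last case: eqP => [->|j1].
    - by rewrite lt_qv eqxx frobenius_invK.
    - by rewrite lt_qu neq_tgt eqxx frobenius_invK.
    rewrite x0 // cE (leq_trans (below_kerF2_le2 hu huv hv _ _)) //.
    by move/eqP: j0; move/eqP: j1; case: (j) => [|[]].
  rewrite (coord_F1 charkp hu huv hv) // coord_at_of /= (negbTE (srcF_nker hu huv hv _)) // (tgtFK hu huv hv) //.
  case: ltnP => [_|ge_j]; first by rewrite frobenius_invK.
  rewrite rmorph0 x1 // -(tgtFK hu huv hv j); apply: (tgtF_ge hu huv hv) => //; last exact: (srcF_nker hu huv hv).
  by apply: leq_trans ge_j; case: (d) dP1 => [/(_ isT)[]|_]; rewrite ?addn1 ?addn0.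
case=> y /(mem_state_space _ dP1)[y0 y1 yd] ->.
apply/(mem_state_space _ dP2); split=> [j le_j|j le_j|cT].
- rewrite (coord_F0 charkp hu huv hv) //; case: eqP => [j0|_]; last case: eqP => [j1|//].
    by rewrite y1 ?rmorph0 // -b0 -j0.
  by rewrite y1 ?rmorph0 // -b1 -j1.
- by rewrite (coord_F1 charkp hu huv hv) // y0 ?rmorph0 //; apply: (srcF_ge hu huv hv).
have [dT nk eq_ab] := cP cT; have [lt_a _ kab] := dP dT; have gE := dg cT.
rewrite (coord_F0 charkp hu huv hv) // (coord_F1 charkp hu huv hv) // -eq_ab -[a - f a]/(tgtF u v a) (srcFK hu huv hv) // (yd dT) -eq_ab.
move: nk; rewrite kab /kerF2 negb_and !negbK; case: (a =P q - v) => [->|_ /= /eqP ->].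
  by rewrite ltnn ltnNge leq_sub2l // ltnW.
by rewrite ltnn ltn_sub2l // (leq_trans huv).
Qed.

(** Only [W :&: Im V] matters for [V^-1(W)], and [Im V = Ker F]: the diagonal vector therefore pulls
    back to a diagonal vector exactly when it lies in [Ker F]. *)
Lemma V_state_space a b (d : bool) :
    a <= q -> b <= q -> (d -> [/\ a < q, a = b & kerF1 u v a = kerF2 q u v a]) ->
    (d && kerF1 u v a -> a + 2 - g a = q - 2 + f a) ->
  forall x, x \in St (b + 2 - g b) (q - 2 + f a) (d && kerF1 u v a)
            <-> V x \in St a b d.
Proof.
move=> le_a le_b dP dg; set c := d && kerF1 u v a.
have cE : c = d && kerF2 q u v b.
  by rewrite /c; case: (d) dP => // /(_ isT)[_ <- ->].
have dP1 : d -> a < q /\ b < q by case/dP=> ? <-.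
have cP : c -> [/\ d, kerF1 u v a & a = b].
  by rewrite /c => /andP[dT nk]; have [_ <-] := dP dT.
have dP2 : c -> b + 2 - g b < q /\ q - 2 + f a < q.
  move=> cT; have [dT nk <-] := cP cT; rewrite dg ?dT //.
  by move: nk; rewrite /kerF1 => /orP[]/eqP->; rewrite rankV.
have b0 : (q - 2 + f a + c <= q - 2) = (a + d <= u - 1) by rewrite (below_kerF1 hu huv hv).
have b1 : (q - 2 + f a + c <= q - 1) = (a + d <= v - 1) by rewrite (below_kerF1 hu huv hv).
have at_a (x : M) : kerF1 u v a ->
    (V x).0_a = psi x.1_(q - 2 + f a).
  rewrite (coord_V0 charkp hu huv hv) // /kerF1 => /orP[]/eqP aE.
    by rewrite aE eqxx rankV.
  by rewrite aE neq_src eqxx rankV.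
move=> x; split.
  case/(mem_state_space _ dP2) => x0 x1 xd.
  apply/(mem_state_space _ dP1); split=> [j le_j|j le_j|dT].
  - rewrite (coord_V0 charkp hu huv hv) //; case: eqP => [ju|_]; last case: eqP => [jv|//].
      by rewrite x1 ?rmorph0 // b0 -ju.
    by rewrite x1 ?rmorph0 // b1 -jv.
  - rewrite (coord_V1 charkp hu huv hv) //; case: ifP => // kj.
    by rewrite x0 ?rmorph0 // cE; apply: (srcV_ge hu huv hv).
  have [lt_a eq_ab kab] := dP dT; rewrite -eq_ab (coord_V1 charkp hu huv hv) // -kab.
  case: ifPn => [ka|]; last first.
    by rewrite (coord_V0 charkp hu huv hv) // /kerF1 negb_or => /andP[/negbTE-> /negbTE->].
  have cT : c by rewrite /c dT.
  by rewrite at_a // (srcV_kerF2 hu huv hv) -?kab // -(xd cT) -eq_ab.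
have psi0 y : psi y = 0%R -> y = 0%R by move/eqP; rewrite fmorph_eq0 => /eqP.
case/(mem_state_space _ dP1) => y0 y1 yd.
apply/(mem_state_space _ dP2); split=> [j le_j|j le_j|cT].
- case: (ltnP j q) => [lt_j|/coord_at_ge //].
  (* Every preimage under [V] contains [e_{1,1}] and [e_{1,2}]; a coordinate past the threshold has
     index at least 2 and is visible in [V x]. *)
  have gt_j : 1 < j by apply: leq_trans (leq_trans (leq_addr _ _) le_j); apply: leq_sub_g.
  apply: psi0; rewrite -(srcVK hu huv hv gt_j) -[RHS](y1 (tgtV q u v j)).
    by rewrite (coord_V1 charkp hu huv hv) // (tgtV_ker hu huv hv).
  by apply: (tgtV_ge hu huv hv) => //; rewrite -cE.
- case: (ltnP j q) => [lt_j|/coord_at_ge //]; apply: psi0.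
  case: (eqVneq j (q - 1)) => [jE|nj].
    rewrite -[RHS](y0 (v - 1)); last by rewrite -b1 -jE.
    by rewrite (coord_V0 charkp hu huv hv) neq_src eqxx jE.
  have jE := between_q (leq_trans (leq_addr _ _) (leq_trans (leq_addr _ _) le_j)) lt_j nj.
  rewrite -[RHS](y0 (u - 1)); last by rewrite -b0; rewrite jE in le_j.
  by rewrite (coord_V0 charkp hu huv hv) // eqxx jE.
have [dT ka eq_ab] := cP cT; have [lt_a _ kab] := dP dT.
have := yd dT; rewrite at_a // -eq_ab (coord_V1 charkp hu huv hv) -kab ka.
by rewrite (srcV_kerF2 hu huv hv) -?kab // => /fmorph_inj ->.
Qed.

End ClosureOfStates.

Lemma dim_state_space (k : fieldType) q a b (d : bool) :
    a <= q -> b <= q -> (d -> a < q /\ b < q) ->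
  \dim (@state_space k q a b d) = a + b + d.
Proof.
move=> le_a le_b dP; have dim0 : \dim (@state_space k q a b false) = a + b.
  by rewrite /state_space dim_coord_space // !count_predT !size_iota.
case: d dP => [/(_ isT)[lt_a lt_b]|_]; last by rewrite dim0 addn0.
rewrite addn1 -dim0.
apply: (dim_step (b := (unit_vec k q 0 a + unit_vec k q 1 b)%R)
  (l := fun x => coord_at x 0%R a)).
- exact: addvSl.
- by apply: (subvP (addvSr _ _)); exact: memv_line.
- apply/mem_state_space => // -[/(_ a)]; rewrite addn0 leqnn => /(_ isT)/eqP.
  by rewrite coord_atD !coord_at_unit // !eqxx /= addr0 oner_eq0.
move=> x /(mem_state_space _ (fun _ => conj lt_a lt_b))[x0 x1 /(_ isT) xd].
rewrite !addn1 in x0 x1; apply/mem_state_space => //; split=> // j; rewrite addn0 leq_eqVlt;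
  rewrite !(coord_atD, coord_atN, coord_atZ) !coord_at_unit //= ?add0r ?addr0.
  by case: eqP => [<- _|_ lt_j]; rewrite ?eqxx ?mulr1 ?subrr // x0 // gtn_eqF // mulr0 subr0.
by case: eqP => [<- _|_ lt_j]; rewrite ?eqxx ?mulr1 ?xd ?subrr // x1 // gtn_eqF // mulr0 subr0.
Qed.

Lemma cap_state_space (k : fieldType) q (P0 P1 : pred nat) a b :
  (@state_space k q a b false :&: coord_space k q P0 P1)%VS
    = coord_space k q (below P0 a) (below P1 b).
Proof.
apply/vspaceP => x; rewrite memv_cap /state_space.
apply/andP/mem_coord_space => [[/mem_coord_space[x0 x1] /mem_coord_space[y0 y1]]|[x0 x1]].
  by split=> j; rewrite negb_and => /orP[]; [exact: y0 | exact: x0 | exact: y1 | exact: x1].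
by split; apply/mem_coord_space; split=> j nj; [apply: x0 | apply: x1 | apply: x0 | apply: x1];
  apply: contra nj => /andP[].
Qed.

(** * Final filtrations encoded by lattice paths *)

Section Paths.

Variables (p : nat) (k : closedFieldType) (charkp : p \in [pchar k]%R).
Variables (q u v : nat).
Hypotheses (hu : 0 < u) (huv : u < v) (hv : v <= q).

Local Notation D := (std_module charkp q u v).
Local Notation K1 := (kerF1 u v).
Local Notation K2 := (kerF2 q u v).
Local Notation f a := ((u <= a) + (v <= a)).
Local Notation g b := ((q - v < b) + (q - u < b)).

Definition eta_state (a b : nat) (d : bool) : nat := f a + (b - g b) + (d && K1 a).

Let count_K1 a : count K1 (iota 0 a) = f a.
Proof.
elim: a => [|a IHa]; first by rewrite /=; lia.
by rewrite -addn1 iotaD count_cat IHa /= /kerF1; lia.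
Qed.

Let count_K2 b : count K2 (iota 0 b) = b - g b.
Proof.
elim: b => [|b IHb] //.
by rewrite -addn1 iotaD count_cat IHb //= /kerF2; lia.
Qed.

Lemma dim_cap_kerF a b (d : bool) : a <= q -> b <= q ->
    (d -> [/\ a < q, a = b & K1 a = K2 a]) ->
  \dim (state_space k q a b d :&: kerF_space k q u v) = eta_state a b d.
Proof.
move=> le_a le_b dP; rewrite /eta_state.
have dim0 : \dim (state_space k q a b false :&: kerF_space k q u v) = f a + (b - g b).
  by rewrite cap_state_space dim_coord_space // count_K1 count_K2.
case: d dP => [/(_ isT)[lt_a eq_ab kab]|_]; last by rewrite dim0 addn0.
rewrite -{b}eq_ab in le_b dim0 *.
have memP x := mem_state_space x (d := true) (fun _ => conj lt_a lt_a).
have memP0 x := @mem_state_space k q a a false x (fun e => match notF e with end).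
case: (boolP (K1 a)) => ka /=; last first.
  (* Membership in [Ker F] makes the coordinate at [a] vanish in both rows, so the diagonal line
     contributes nothing. *)
  rewrite addn0 -dim0; congr (\dim _); apply/vspaceP => x; rewrite !memv_cap.
  case: (boolP (x \in kerF_space _ _ _ _)) => [/mem_coord_space[y0 y1]|]; rewrite ?andbF // !andbT.
  apply/memP/memP0 => -[x0 x1 xd]; last first.
    split=> [j|j|_]; rewrite ?addn1; last by rewrite x0 ?x1 ?addn0.
    - by move=> /ltnW lt_j; apply: x0; rewrite addn0.
    by move=> /ltnW lt_j; apply: x1; rewrite addn0.
  split=> // j; rewrite addn0 leq_eqVlt => /predU1P[<-|lt_j].
  - exact: y0.
  - by apply: x0; rewrite addn1.
  - by apply: y1; rewrite -kab.
  by apply: x1; rewrite addn1.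
rewrite addn1 -dim0; set e := (unit_vec k q 0%R a + unit_vec k q 1%R a)%R.
have eK : e \in kerF_space k q u v.
  apply/mem_coord_space; split=> j nj; rewrite coord_atD !coord_at_unit //= ?addr0 ?add0r.
    by case: eqP nj => // ->; rewrite ka.
  by case: eqP nj => // ->; rewrite -kab ka.
have eS : e \in state_space k q a a true.
  by apply: (subvP (addvSr _ _)); exact: memv_line.
apply: (dim_step (b := e) (l := fun x => coord_at x 0%R a)).
- by apply: capvS => //; exact: addvSl.
- by rewrite memv_cap eS.
- rewrite memv_cap negb_and; apply/orP; left; apply/memP0 => -[/(_ a)].
  rewrite addn0 leqnn => /(_ isT)/eqP.
  by rewrite coord_atD !coord_at_unit // !eqxx /= addr0 oner_eq0.
move=> x; rewrite !memv_cap => /andP[/memP[x0 x1 /(_ isT) xd] xK].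
apply/andP; split; last by apply: rpredB => //; apply: rpredZ.
rewrite !addn1 in x0 x1; apply/memP0; split=> // j; rewrite addn0 leq_eqVlt;
  rewrite !(coord_atD, coord_atN, coord_atZ) !coord_at_unit //= ?add0r ?addr0.
  by case: eqP => [<- _|_ lt_j]; rewrite ?eqxx ?mulr1 ?subrr // x0 // gtn_eqF // mulr0 subr0.
by case: eqP => [<- _|_ lt_j]; rewrite ?eqxx ?mulr1 ?xd ?subrr // x1 // gtn_eqF // mulr0 subr0.
Qed.

Variables (a b : nat -> nat) (d : nat -> bool).

(* The j-th member of the flag is state_space (a j) (b j) (d j); path_F and path_V
   give its image under F and its preimage under V. *)
Record final_path : Prop := FinalPath {
  path_start : [/\ a 0 = 0, b 0 = 0 & d 0 = false];
  path_end : [/\ a (2 * q) = q, b (2 * q) = q & d (2 * q) = false];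
  path_dim : forall j, j <= 2 * q -> [/\ a j + b j + d j = j, a j <= q & b j <= q];
  path_le : forall j, j < 2 * q -> a j + d j <= a j.+1 /\ b j + d j <= b j.+1;
  path_diag : forall j, j <= 2 * q -> d j ->
    [/\ a j < q, a j = b j & K1 (a j) = K2 (a j)];
  path_diagF : forall j, j <= 2 * q -> d j && ~~ K1 (a j) ->
    g (a j) = a j - f (a j);
  path_diagV : forall j, j <= 2 * q -> d j && K1 (a j) ->
    a j + 2 - g (a j) = q - 2 + f (a j);
  path_F : forall j, j <= 2 * q -> exists2 i, i <= 2 * q &
    [/\ a i = g (b j), b i = a j - f (a j) & d i = d j && ~~ K1 (a j)];
  path_V : forall j, j <= 2 * q -> exists2 i, i <= 2 * q &
    [/\ a i = b j + 2 - g (b j), b i = q - 2 + f (a j) & d i = d j && K1 (a j)]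
}.

Hypothesis pathP : final_path.

Let W (j : nat) : {vspace D} := state_space k q (a j) (b j) (d j).

Let dlt j : j <= 2 * q -> d j -> a j < q /\ b j < q.
Proof. by move=> le_j /(path_diag pathP le_j)[? <-]. Qed.

Lemma final_path_filtration : final_filtration q W.
Proof.
have [[a0 b0 d0] [a2 b2 d2] dimP leP diagP dF dV FP VP] := pathP.
have dimW j : j <= 2 * q -> \dim (W j) = j.
  move=> le_j; have [dimE le_a le_b] := dimP j le_j.
  by rewrite /W dim_state_space //; exact: dlt.
split=> //.
- split; last by apply/eqP; rewrite -dimv_leqif_eq ?subvf // dimW // dimvf /= dim_matrix.
  by apply/eqP; rewrite -dimv_eq0 dimW.
- move=> j lt_j; have [leA leB] := leP j lt_j.
  apply/subvP => x /(mem_state_space _ (@dlt j (ltnW lt_j)))[x0 x1 _].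
  apply/(mem_state_space _ (@dlt j.+1 lt_j)); split=> [i|i|_].
  - by move=> le_i; apply: x0; apply: leq_trans leA (leq_trans (leq_addr _ _) le_i).
  - by move=> le_i; apply: x1; apply: leq_trans leB (leq_trans (leq_addr _ _) le_i).
  by rewrite x0 ?x1.
- move=> j le_j; have [_ le_a le_b] := dimP j le_j.
  have [i le_i [ai bi di]] := FP j le_j; exists i => // x; rewrite /W ai bi di.
  by apply: F_state_space => //; [exact: diagP | exact: dF].
move=> j le_j; have [_ le_a le_b] := dimP j le_j.
have [i le_i [ai bi di]] := VP j le_j; exists i => // x; rewrite /W ai bi di.
by apply: V_state_space => //; [exact: diagP | exact: dV].
Qed.

Lemma final_path_perm : let h j := eta_state (a j) (b j) (d j) in
  (exists w : 'S_(2 * q), siegel_EO_perm D w)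
  /\ forall w : 'S_(2 * q), siegel_EO_perm D w ->
     forall i : 'I_(2 * q), w i = (if jump h i then h i else q + (i - h i)) :> nat.
Proof.
have finW := final_path_filtration.
have kerK : @is_kerF _ _ _ D (kerF_space k q u v) by move=> x; exact: mem_kerF.
have dimK := dim_kerF charkp hu huv hv.
have imV : forall x : D, dm_F D x = 0%R <-> exists y : D, x = dm_V D y.
  by move=> x; exact: ker_im_V.
move=> h; split; first exact: siegel_EO_perm_exists kerK dimK W finW.
have hE j : j <= 2 * q -> Defs.eta W (kerF_space k q u v) j = h j.
  move=> le_j; have [_ le_a le_b] := path_dim pathP le_j.
  by apply: dim_cap_kerF => //; exact: path_diag pathP _ le_j.
move=> w siw i; have := siegel_EO_permE kerK dimK imV finW siw i.
by rewrite /jump !hE // ltnW.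
Qed.

End Paths.

(** * Explicit final filtrations *)

Section Shuffles.

Variables (q u v : nat).
Hypotheses (hu : 0 < u) (huv : u < v) (hv : v <= q).

Local Notation f a := ((u <= a) + (v <= a)).
Local Notation g b := ((q - v < b) + (q - u < b)).

Variables (P1 P2 P3 P4 : nat) (dg : pred nat).
Hypotheses (lt12 : P1 < P2) (lt2q : P2 < q) (leq3 : q <= P3) (lt34 : P3 < P4)
  (lt4q : P4 < 2 * q) (dgq : ~~ dg q).

(* P1 < P2 and P3 < P4 are the 0-based positions of e_{1,1}, e_{1,2} and of
   e_{2,q-1}, e_{2,q} in the shuffle, and dg the indices j where the j-th member is
   replaced by one containing e_{1,c+1} + e_{2,c+1}. *)
Definition row1_count (j : nat) : nat :=
  if j <= P1 then 0 else if j <= P2 then 1 else if j <= q then 2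
  else if j <= P3 then j - q + 2 else if j <= P4 then j - q + 1 else j - q.

Definition row2_count (j : nat) : nat := j - row1_count j.

(** An image [F(W_j)] has [n] vectors of row one and [m] of row two; the hypotheses make the shuffle
    pass through that state, necessarily at step [n + m]. *)
Lemma row1_countD n m : n <= 2 -> m <= q - 2 ->
    (n = 0 -> m <= P1) -> (n = 1 -> P1 <= m < P2) -> (n = 2 -> P2 <= m.+1) ->
  row1_count (n + m) = n.
Proof. by rewrite /row1_count => *; do ![case: ifP => ?]; lia. Qed.

Lemma row2_countD n m : n <= 2 -> 2 <= m <= q ->
    (n = 0 -> m + (q - 2) <= P3) -> (n = 1 -> P3 <= m + (q - 2) < P4) ->
    (n = 2 -> P4 <= (m + (q - 2)).+1) ->
  row1_count (m + (q - 2 + n)) = m.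
Proof. by rewrite /row1_count => *; do ![case: ifP => ?]; lia. Qed.

Lemma row1_count_step j : j < 2 * q ->
  row1_count j <= row1_count j.+1 <= (row1_count j).+1.
Proof. by rewrite /row1_count => *; do ![case: ifP => ?]; lia. Qed.

Lemma row_count_le j : j <= 2 * q ->
  [/\ row1_count j <= j, row1_count j <= q & row2_count j <= q].
Proof. by rewrite /row2_count /row1_count => ?; do ![case: ifP => ?]; split; lia. Qed.

Lemma tgt_count_le2 a b : f a <= 2 /\ g b <= 2.
Proof. by split; apply: (leq_add (leq_b1 _) (leq_b1 _)). Qed.

Lemma tgtV_count_bounds b : b <= q -> 2 <= b + 2 - g b <= q.
Proof.
by case: (ltngtP b (q - v)) => ?; case: (ltngtP b (q - u)) => ? /= ?; lia.
Qed.

(** [e_{1,1}] enters [F(W_j)] when [e_{2,q-v+1}] enters [W_j], and [e_{1,2}] when [e_{2,q-u+1}]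
    does. Just before and just after these moments the inequalities pinch [P1] and [P2] to their
    fixed-point values. The last clause keeps the image off the diagonal steps. *)
Definition shuffle_F : Prop := forall j, j <= 2 * q -> ~~ dg j ->
  let n := row2_count j in let m := tgtF u v (row1_count j) in
  [/\ n <= q - v -> m <= P1, q - v < n -> n <= q - u -> P1 <= m < P2,
      q - u < n -> P2 <= m.+1 & ~~ dg (g n + m)].

(** Here [P3] and [P4] are pinched: [e_{2,q-1}] and [e_{2,q}] enter [V^-1(W_j)] when [e_{1,u}] and
    [e_{1,v}] enter [W_j]. *)
Definition shuffle_V : Prop := forall j, j <= 2 * q -> ~~ dg j ->
  let n := row1_count j in let m := row2_count j + 2 - g (row2_count j) in
  [/\ n < u -> m + (q - 2) <= P3, u <= n -> n < v -> P3 <= m + (q - 2) < P4,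
      v <= n -> P4 <= (m + (q - 2)).+1 & ~~ dg (m + (q - 2 + f n))].

(** At such a [j] the shuffle has just added [e_{1,c+1}] and adds [e_{2,c+1}] next. In the first
    alternative the modified member is fixed by [F] and its preimage under [V] is [W_q]; in the
    second it is fixed by [V^-1] and its image under [F] is [W_q]. *)
Definition shuffle_diag : Prop := forall j, j <= 2 * q -> dg j ->
  let c := row2_count j in
  [/\ row1_count j = c.+1, row1_count j.-1 = c, row1_count j.+1 = c.+1
    & [/\ f c = 0, g c = c & ~~ kerF1 u v c /\ ~~ kerF2 q u v c]
      \/ [/\ q - 2 + f c = c, g c = 2 & kerF1 u v c /\ kerF2 q u v c]].

Lemma shuffle_final_path : shuffle_F -> shuffle_V -> shuffle_diag ->
  final_path q u v (fun j => row1_count j - dg j) row2_count dg.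
Proof.
move=> HF HV Hd.
have r1_0 : row1_count 0 = 0 by [].
have r1_2q : row1_count (2 * q) = q.
  by rewrite /row1_count; do ![case: ifP => ?]; lia.
have r2_0 : row2_count 0 = 0 by [].
have r2_2q : row2_count (2 * q) = q by rewrite /row2_count r1_2q; lia.
have dg0 : dg 0 = false.
  by apply/negP => /(Hd 0 (leq0n _))[]; rewrite r1_0 r2_0.
have dg2q : dg (2 * q) = false.
  apply/negP => /(Hd _ (leqnn _))[]; rewrite r1_2q r2_2q => qq _ _ _.
  by move: (ltnn q); rewrite [X in _ < X]qq ltnSn.
have sumE j : j <= 2 * q -> row1_count j + row2_count j = j.
  by move=> /row_count_le[? _ _]; rewrite subnKC.
have lt_c j : j <= 2 * q -> dg j -> row2_count j < q.
  by move=> le_j /(Hd j le_j)[<- _ _ _]; have [] := row_count_le le_j.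
have r1q : row1_count q = 2.
  by rewrite /row1_count leqnn; do ![case: ifP => ?]; lia.
have r2q : row2_count q = q - 2 by rewrite /row2_count r1q.
have tgtF_le a : a <= q -> tgtF u v a <= q - 2 by rewrite /tgtF; lia.
split.
- by rewrite r1_0 dg0.
- by rewrite r1_2q dg2q subn0.
- move=> j le_j; have [? le_a le_b] := row_count_le le_j; split=> //.
    case: (boolP (dg j)) => dj; last by rewrite subn0 addn0 sumE.
    have [r1E _ _ _] := Hd j le_j dj; have := sumE j le_j; lia.
  exact: leq_trans (leq_subr _ _) le_a.
- move=> j lt_j; have /andP[st st'] := row1_count_step lt_j.
  have le_j := ltnW lt_j; have s1 := sumE _ lt_j; have s0 := sumE _ le_j.
  case: (boolP (dg j)) => dj; case: (boolP (dg j.+1)) => dj1; rewrite ?subn0 ?addn0.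
  + have [e1 _ e2 _] := Hd j le_j dj; have [e3 e4 _ _] := Hd _ lt_j dj1.
    by rewrite /= in e4; lia.
  + by have [e1 _ e2 _] := Hd j le_j dj; lia.
  + by have [e3 e4 _ _] := Hd _ lt_j dj1; rewrite /= in e4; lia.
  by lia.
- move=> j le_j dj; have [r1E _ _ ker] := Hd j le_j dj.
  rewrite dj r1E subn1; split=> //; first exact: lt_c.
  by case: ker => [][_ _ []]; [move=> /negbTE-> /negbTE-> | move=> -> ->].
- move=> j le_j /andP[dj]; have [r1E _ _ ker] := Hd j le_j dj.
  by rewrite dj r1E subn1; case: ker => [[-> -> _]|[_ _ [-> _]]]; rewrite ?subn0.
- move=> j le_j /andP[dj]; have [r1E _ _ ker] := Hd j le_j dj.
  rewrite dj r1E subn1; case: ker => [[_ _ [/negbTE-> _]] //|[-> -> _] _].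
  by rewrite addnK.
- move=> j le_j; case: (boolP (dg j)) => dj.
    have [r1E _ _ ker] := Hd j le_j dj; rewrite r1E subn1.
    case: ker => [[fc gc [nk _]]|[fc gc [kc _]]].
      by exists j => //; rewrite dj r1E subn1 fc gc subn0 nk.
    exists q; first by rewrite leq_pmull.
    by rewrite (negbTE dgq) subn0 kc r1q r2q gc -[X in _ = X - _]fc addnK.
  have [H0 H1 H2 nd] := HF j le_j dj.
  have [_ le_n] := tgt_count_le2 0 (row2_count j).
  have [_ le_a _] := row_count_le le_j; have le_m := tgtF_le _ le_a.
  exists (g (row2_count j) + tgtF u v (row1_count j)); first by lia.
  have r1E : row1_count (g (row2_count j) + tgtF u v (row1_count j)) = g (row2_count j).
    by apply: row1_countD => // e; [apply: H0 | apply: H1 | apply: H2]; move: e; clear -huv hv; lia.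
  by rewrite (negbTE nd) !subn0 /row2_count r1E addKn.
- move=> j le_j; case: (boolP (dg j)) => dj.
    have [r1E _ _ ker] := Hd j le_j dj; rewrite r1E subn1.
    case: ker => [[fc gc [nk _]]|[fc gc [kc _]]].
      exists q; first by rewrite leq_pmull.
      by rewrite (negbTE dgq) subn0 (negbTE nk) r1q r2q fc gc addKn addn0.
    by exists j => //; rewrite dj r1E subn1 fc gc addnK kc.
have [H0 H1 H2 nd] := HV j le_j dj.
have [_ _ le_b] := row_count_le le_j.
set m := row2_count j + 2 - g (row2_count j) in H0 H1 H2 nd *.
have le_m : 2 <= m <= q by apply: tgtV_count_bounds.
have [le_n _] := tgt_count_le2 (row1_count j) 0.
exists (m + (q - 2 + f (row1_count j))).
  by move: le_m le_n; clear -lt12 lt2q; move: (f _) => n; lia.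
have r1E : row1_count (m + (q - 2 + f (row1_count j))) = m.
  by apply: row2_countD => // e; [apply: H0 | apply: H1 | apply: H2]; move: e; clear -huv; lia.
by rewrite (negbTE nd) !subn0 /row2_count r1E addKn.
Qed.

End Shuffles.

Variant row1_spec (q P1 P2 P3 P4 j : nat) : nat -> Prop :=
  | Row1None of j <= P1 : row1_spec q P1 P2 P3 P4 j 0
  | Row1One of P1 < j <= P2 : row1_spec q P1 P2 P3 P4 j 1
  | Row1Two of P2 < j <= q : row1_spec q P1 P2 P3 P4 j 2
  | Row1Up of q < j <= P3 : row1_spec q P1 P2 P3 P4 j (j - q + 2)
  | Row1UpOne of P3 < j <= P4 : row1_spec q P1 P2 P3 P4 j (j - q + 1)
  | Row1UpTwo of P4 < j : row1_spec q P1 P2 P3 P4 j (j - q).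

Lemma row1_countP q P1 P2 P3 P4 j :
  row1_spec q P1 P2 P3 P4 j (row1_count q P1 P2 P3 P4 j).
Proof.
rewrite /row1_count; do ![case: ifPn]; rewrite -?ltnNge => *; constructor => //;
  exact/andP.
Qed.

(* Deciding the comparisons one at a time and dropping the impossible branches
   early is much faster than leaving the booleans to lia. *)
Ltac cmp_lia :=
  try (exfalso; lia);
  first [case: leqP => ? /=; cmp_lia | lia].

Ltac shuffle_F_lia :=
  move=> j ? /= ?; rewrite /row2_count /tgtF; case: row1_countP => ? /=; split=> //; cmp_lia.

Ltac shuffle_V_lia :=
  move=> j ? /= ?; rewrite /row2_count; case: row1_countP => ? /=; split=> //; cmp_lia.

Ltac shuffle_diag_lia :=
  rewrite /row2_count; do ![case: row1_countP => ?]; rewrite /kerF1 /kerF2; lia.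

Ltac eta_lia :=
  rewrite /eta_state /row2_count /kerF1 /=; case: row1_countP => ? /=; cmp_lia.

(** * Solutions of the fixed-point conditions, case by case *)

Section Cases.

Variables (p : nat) (k : closedFieldType) (charkp : p \in [pchar k]%R).
Variables (q u v : nat).
Hypotheses (hu : 0 < u) (huv : u < v) (hv : v <= q).

Definition perm_profile (n : nat) (h : nat -> nat) : Prop :=
  (exists w : 'S_(2 * q), siegel_EO_perm (std_module charkp q u v) w)
  /\ forall w : 'S_(2 * q), siegel_EO_perm (std_module charkp q u v) w ->
     forall i : 'I_(2 * q), i < n ->
     w i = (if h i.+1 == (h i).+1 then h i else q + (i - h i)) :> nat.

Lemma shuffle_profile P1 P2 P3 P4 (dg : pred nat) n (h : nat -> nat) :
    n <= 2 * q -> P1 < P2 -> P2 < q -> q <= P3 -> P3 < P4 -> P4 < 2 * q -> ~~ dg q ->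
    shuffle_F q u v P1 P2 P3 P4 dg -> shuffle_V q u v P1 P2 P3 P4 dg ->
    shuffle_diag q u v P1 P2 P3 P4 dg ->
    (forall j, j <= n -> eta_state q u v (row1_count q P1 P2 P3 P4 j - dg j)
                           (row2_count q P1 P2 P3 P4 j) (dg j) = h j) ->
  perm_profile n h.
Proof.
move=> le_n lt12 lt2 le3 lt34 lt4 dgq HF HV Hd hE.
have pathP := shuffle_final_path hu huv hv lt12 lt2 le3 lt34 lt4 dgq HF HV Hd.
have [ex_w wE] := final_path_perm charkp hu huv hv pathP.
split=> // w siw i lt_i; rewrite (wE w siw i) /jump !hE //; exact: ltnW.
Qed.

(* Below, profile_x is case (x) of the theorem; h counts the jumps before j, that
   is j minus the number of (0-based) non-jump positions smaller than j. *)
Lemma profile_ordinary : u = 1 -> v = 2 ->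
  perm_profile (2 * q) (fun j => minn j q).
Proof.
move=> uE vE.
apply: (@shuffle_profile 0 (q - 1) q (2 * q - 1) pred0); try (by clear -hu huv hv uE vE; lia); try by [].
- clear -hu huv hv uE vE; rewrite uE vE; shuffle_F_lia.
- clear -hu huv hv uE vE; rewrite uE vE; shuffle_V_lia.
clear -hu huv hv uE vE; rewrite uE vE; move=> j le_j; eta_lia.
Qed.

Lemma profile_a : u = 1 -> 2 < v ->
  perm_profile q (fun j => j - ((q + 1 - v < j) + (q - 1 < j))).
Proof.
move=> uE v_gt2.
apply: (@shuffle_profile 0 (q - 1) q (2 * q - 1) pred0); try (by clear -hu huv hv uE v_gt2; lia); try by [].
- clear -hu huv hv uE v_gt2; rewrite uE; shuffle_F_lia.
- clear -hu huv hv uE v_gt2; rewrite uE; shuffle_V_lia.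
clear -hu huv hv uE v_gt2; rewrite uE; move=> j le_j; eta_lia.
Qed.

(** [P2] is 1 plus the number of [e_{1,j}] outside [Ker F] before [e_{2,q-1}]. There are
    [q - v + 2 < v] vectors of row one before it, so [e_{1,v}] comes later and only [e_{1,2}] is
    discounted. *)
Lemma profile_c : u = 2 -> v < q -> q + 1 - v <= v - 2 ->
  perm_profile q (fun j => j - ((1 < j) + (q + 1 - v < j))).
Proof.
move=> uE v_lt v_ge.
apply: (@shuffle_profile 1 (q + 2 - v) (2 * q - v) (2 * q - 2) pred0); try (by clear -hu huv hv uE v_lt v_ge; lia); try by [].
- clear -hu huv hv uE v_lt v_ge; rewrite uE; shuffle_F_lia.
- clear -hu huv hv uE v_lt v_ge; rewrite uE; shuffle_V_lia.
clear -hu huv hv uE v_lt v_ge; rewrite uE; move=> j le_j; eta_lia.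
Qed.

(** Now exactly [e_{1,1}, ..., e_{1,v}] precede [e_{2,q-1}], so both [e_{1,2}] and [e_{1,v}] are
    discounted and [P2 = 1 + (v - 2)]. *)
Lemma profile_d : u = 2 -> v < q -> v - 2 < q + 1 - v ->
  perm_profile q (fun j => j - ((1 < j) + (q + 2 - v < j))).
Proof.
move=> uE v_lt v_le.
apply: (@shuffle_profile 1 (v - 1) (q + v - 2) (2 * q - 2) pred0); try (by clear -hu huv hv uE v_lt v_le; lia); try by [].
- clear -hu huv hv uE v_lt v_le; rewrite uE; shuffle_F_lia.
- clear -hu huv hv uE v_lt v_le; rewrite uE; shuffle_V_lia.
clear -hu huv hv uE v_lt v_le; rewrite uE; move=> j le_j; eta_lia.
Qed.

(** The flag starts with [e_{2,1}, e_{1,1}, e_{2,2}, e_{1,2}]: one vector of row one precedes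
    [e_{2,q-v+1} = e_{2,2}], and two precede [e_{2,q-u+1}]. *)
Lemma profile_e : 2 < u -> u < q - 1 -> v = q - 1 ->
  perm_profile q (fun j => j - ((1 < j) + (2 < j) + (3 < j) + (q + 2 - u < j))).
Proof.
move=> u_gt2 u_lt vE.
apply: (@shuffle_profile 1 3 (2 * q - 4) (2 * q - 2) pred0); try (by clear -hu huv hv u_gt2 u_lt vE; lia); try by [].
- clear -hu huv hv u_gt2 u_lt vE; rewrite vE; shuffle_F_lia.
- clear -hu huv hv u_gt2 u_lt vE; rewrite vE; shuffle_V_lia.
clear -hu huv hv u_gt2 u_lt vE; rewrite vE; move=> j le_j; eta_lia.
Qed.

(** The flag starts with [e_{2,1}, e_{2,2}, e_{1,1}, e_{1,2}]: as [q - v >= 2], both vectors of row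
    one, outside [Ker F] by [2 < u], precede [e_{2,q-v+1}]. *)
Lemma profile_g : 2 < u -> v < q - 1 ->
  perm_profile q (fun j => j - ((2 < j) + (3 < j) + (q + 2 - v < j) + (q + 2 - u < j))).
Proof.
move=> u_gt2 v_lt.
apply: (@shuffle_profile 2 3 (2 * q - 4) (2 * q - 3) pred0); try (by clear -hu huv hv u_gt2 v_lt; lia); try by [].
- clear -hu huv hv u_gt2 v_lt; shuffle_F_lia.
- clear -hu huv hv u_gt2 v_lt; shuffle_V_lia.
clear -hu huv hv u_gt2 v_lt; move=> j le_j; eta_lia.
Qed.

(** The shuffle lists [e_{1,1}] just before [e_{2,1}] and [e_{1,q}] just before [e_{2,q}]; [dg]
    replaces the member between the two vectors of each swapped pair. *)
Lemma profile_b : u = 2 -> v = q ->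
  perm_profile q (fun j => j - ((0 < j) + (1 < j))).
Proof.
move=> uE vE.
apply: (@shuffle_profile 0 2 q (2 * q - 1) (fun j => (j == 1) || (j == 2 * q - 1))); try (by clear -hu huv hv uE vE; lia); try by [].
- clear -hu huv hv uE vE; rewrite uE vE; shuffle_F_lia.
- clear -hu huv hv uE vE; rewrite uE vE; shuffle_V_lia.
- clear -hu huv hv uE vE; move=> ? _ /orP[]/eqP->; split; try shuffle_diag_lia;
  [left | right]; split; try split; shuffle_diag_lia.
clear -hu huv hv uE vE; rewrite uE vE; move=> j le_j;
(* Only [j <= q] is in question, which excludes [2 * q - 1]. *)
rewrite (_ : _ || _ = (j == 1)); last lia.
case: (j =P 1) le_j => [->|?] le_j; eta_lia.
Qed.

Lemma profile_f : 2 < u -> u < q - 1 -> v = q ->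
  perm_profile q (fun j => j - ((0 < j) + (1 < j) + (3 < j) + (q + 2 - u < j))).
Proof.
move=> u_gt2 u_lt vE.
apply: (@shuffle_profile 0 3 (2 * q - 4) (2 * q - 1) (fun j => (j == 1) || (j == 2 * q - 1))); try (by clear -hu huv hv u_gt2 u_lt vE; lia); try by [].
- clear -hu huv hv u_gt2 u_lt vE; rewrite vE; shuffle_F_lia.
- clear -hu huv hv u_gt2 u_lt vE; rewrite vE; shuffle_V_lia.
- clear -hu huv hv u_gt2 u_lt vE; move=> ? _ /orP[]/eqP->; split; try shuffle_diag_lia;
  [left | right]; split; try split; shuffle_diag_lia.
clear -hu huv hv u_gt2 u_lt vE; rewrite vE; move=> j le_j;
rewrite (_ : _ || _ = (j == 1)); last lia.
case: (j =P 1) le_j => [->|?] le_j; eta_lia.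
Qed.

(** Besides the outer pairs, [F] swaps [e_{1,2}] and [e_{2,2}], and [V] swaps [e_{1,q-1}] and
    [e_{2,q-1}]; this adds the diagonal steps 3 and [2 * q - 3]. *)
Lemma profile_h : 2 < u -> u = q - 1 -> v = q ->
  perm_profile q (fun j => j - ((0 < j) + (1 < j) + (2 < j) + (3 < j))).
Proof.
move=> u_gt2 uE vE.
apply: (@shuffle_profile 0 2 (2 * q - 3) (2 * q - 1) (fun j => [|| j == 1, j == 2 * q - 1, j == 3 | j == 2 * q - 3])); try (by clear -hu huv hv u_gt2 uE vE; lia); try by [].
- clear -hu huv hv u_gt2 uE vE; rewrite uE vE; shuffle_F_lia.
- clear -hu huv hv u_gt2 uE vE; rewrite uE vE; shuffle_V_lia.
- clear -hu huv hv u_gt2 uE vE; move=> ? _ /or4P[]/eqP->; split; try shuffle_diag_lia;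
  [left | right | left | right]; split; try split; shuffle_diag_lia.
clear -hu huv hv u_gt2 uE vE; rewrite uE vE; move=> j le_j;
rewrite (_ : [|| _, _, _ | _] = (j == 1) || (j == 3)); last lia.
case: (j =P 1) le_j => [->|?] le_j; last case: (j =P 3) le_j => [->|?] le_j; eta_lia.
Qed.

End Cases.

(** * From the profiles to the values of the permutation *)

Lemma profile_first_half (p : nat) (k : closedFieldType) (charkp : p \in [pchar k]%R)
    (q u v : nat) (h f : nat -> nat) (w : 'S_(2 * q)) :
    perm_profile charkp q u v q h ->
    siegel_EO_perm (std_module charkp q u v) w ->
    (forall n, n < q ->
       (if h n.+1 == (h n).+1 then h n else q + (n - h n)).+1 = f n.+1) ->
  first_half_eq w f.
Proof. by case=> _ wE siw hf i lt_i; rewrite (wE w siw i lt_i); apply: hf. Qed.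

Ltac first_half_lia :=
  try (exfalso; lia);
  first [case: leqP => ? /=; first_half_lia | case: eqP => ? /=; first_half_lia | lia].

Theorem theorem5p2 (p : nat) (hp : 2 < p) (k : closedFieldType)
    (charkp : p \in [pchar k]%R)
    (phi : {rmorphism 'F_p -> k}) (algk : integralRange phi)
    (q u v : nat) (hq : 2 <= q) (hu : 1 <= u) (huv : u < v) (hv : v <= q) :
  (exists w : 'S_(2 * q), siegel_EO_perm (std_module charkp q u v) w)
  /\
  forall w : 'S_(2 * q), siegel_EO_perm (std_module charkp q u v) w ->
  [/\ (u = 1 -> v = 2 -> w = 1%g),
      (u = 1 -> 2 < v -> first_half_eq w (fun i =>
         if i < q + 2 - v then i
         else if i == q + 2 - v then q + 1
         else if i < q then i - 1
         else q + 2)),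
      (u = 2 -> v = q -> first_half_eq w (fun i =>
         if i <= 2 then q + i
         else i - 2)),
      (u = 2 -> 1 < q + 1 - v <= v - 2 -> first_half_eq w (fun i =>
         if i == 1 then 1
         else if i == 2 then q + 1
         else if i < q + 2 - v then i - 1
         else if i == q + 2 - v then q + 2
         else i - 2))
    & [/\ (u = 2 -> q + 1 - v > v - 2 -> first_half_eq w (fun i =>
         if i == 1 then 1
         else if i == 2 then q + 1
         else if i < q + 3 - v then i - 1
         else if i == q + 3 - v then q + 2
         else i - 2)),
      (2 < u < q - 1 -> v = q - 1 -> first_half_eq w (fun i =>
         if i == 1 then 1
         else if i <= 4 then q + i - 1
         else if i < q + 3 - u then i - 3
         else if i == q + 3 - u then q + 4
         else i - 4)),
      (2 < u < q - 1 -> v = q -> first_half_eq w (fun i =>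
         if i <= 2 then q + i
         else if i == 3 then 1
         else if i == 4 then q + 3
         else if i < q + 3 - u then i - 3
         else if i == q + 3 - u then q + 4
         else i - 4)),
      (2 < u < q - 1 -> v < q - 1 -> first_half_eq w (fun i =>
         if i <= 2 then i
         else if i <= 4 then q + i - 2
         else if i < q + 3 - v then i - 2
         else if i == q + 3 - v then q + 3
         else if i < q + 3 - u then i - 3
         else if i == q + 3 - u then q + 4
         else i - 4))
    & (2 < u -> u = q - 1 -> first_half_eq w (fun i =>
         if i <= 4 then q + i
         else i - 4))]].
Proof.
have prof0 := profile_ordinary charkp hu huv hv.
have profa := profile_a charkp hu huv hv.
have profb := profile_b charkp hu huv hv.
have profc := profile_c charkp hu huv hv.
have profd := profile_d charkp hu huv hv.
have profe := profile_e charkp hu huv hv.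
have proff := profile_f charkp hu huv hv.
have profg := profile_g charkp hu huv hv.
have profh := profile_h charkp hu huv hv.
split.
  have [u1|[u2|u3]] : u = 1 \/ u = 2 \/ 2 < u by clear -hu; lia.
  - have [v2|v3] : v = 2 \/ 2 < v by clear -huv u1; lia.
      exact: proj1 (prof0 u1 v2).
    exact: proj1 (profa u1 v3).
  - have [vE|[[v_lt ge]|[v_lt lt]]] :
      v = q \/ (v < q /\ q + 1 - v <= v - 2) \/ (v < q /\ v - 2 < q + 1 - v).
      by clear -hv; lia.
    + exact: proj1 (profb u2 vE).
    + exact: proj1 (profc u2 v_lt ge).
    exact: proj1 (profd u2 v_lt lt).
  have [[uE vE]|[[u_lt vE]|[[u_lt vE]|v_lt]]] : (u = q - 1 /\ v = q) \/
      (u < q - 1 /\ v = q - 1) \/ (u < q - 1 /\ v = q) \/ v < q - 1.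
    by clear -huv hv; lia.
  - exact: proj1 (profh u3 uE vE).
  - exact: proj1 (profe u3 u_lt vE).
  - exact: proj1 (proff u3 u_lt vE).
  exact: proj1 (profg u3 v_lt).
move=> w siw; split=> [u1 v2|u1 v3|u2 vE|u2 /andP[gt ge]|].
- apply/permP => i; apply: val_inj; rewrite perm1 /=.
  rewrite (proj2 (prof0 u1 v2) w siw i (ltn_ord i)); have := ltn_ord i.
  clear -hq; move: (nat_of_ord i) => n lt_n; case: eqP => ?; lia.
- apply: (profile_first_half (profa u1 v3) siw); clear -hq v3 hv; move=> n ?; first_half_lia.
- apply: (profile_first_half (profb u2 vE) siw); clear -hq; move=> n ?; first_half_lia.
- have v_lt : v < q by clear -gt; lia.
  apply: (profile_first_half (profc u2 v_lt ge) siw).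
  by clear -v_lt gt ge u2 huv; move=> n ?; first_half_lia.
split=> [u2 lt|/andP[u3 u_lt] vE|/andP[u3 u_lt] vE|/andP[u3 u_lt] v_lt|u3 uE].
(* For [v = q] the assumption would read [q - 2 < 1], against [2 = u < v]. *)
- have v_lt : v < q by clear -hv huv u2 lt; lia.
  apply: (profile_first_half (profd u2 v_lt lt) siw).
  by clear -v_lt lt u2 huv; move=> n ?; first_half_lia.
- apply: (profile_first_half (profe u3 u_lt vE) siw); clear -u3 u_lt; move=> n ?; first_half_lia.
- apply: (profile_first_half (proff u3 u_lt vE) siw); clear -u3 u_lt; move=> n ?; first_half_lia.
- apply: (profile_first_half (profg u3 v_lt) siw); clear -u3 huv v_lt; move=> n ?; first_half_lia.
have vE : v = q by clear -hv huv uE; lia.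
apply: (profile_first_half (profh u3 uE vE) siw); clear -u3 uE; move=> n ?; first_half_lia.
Qed.
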